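(* In the setting of the context, fix $x\in\mathcal X$ (write $\ell_k(z)=\ell_k(x,z)$), $i\in[N]$, $b_i\in\mathbb R_+$ and $1\le k_1<k_2\le K$. Suppose the regularity assumption and the local worst-case oracle assumption hold. Then the algorithm PairEval described in the context, run with oracle precision $\epsilon>0$ and golden-section tolerance $\eta>0$, returns a feasible local solution $\hat s$ (a feasible point $(\alpha_1,\alpha_2,\beta_1,\beta_2,v_1,v_2)$ of the problem defining $V_i^{(k_1,k_2)}(b_i)$) and a value $\hat V_i^{(k_1,k_2)}(b_i)$ satisfying $$\Big|V_i^{(k_1,k_2)}(b_i)-\hat V_i^{(k_1,k_2)}(b_i)\Big|\le\begin{cases}O\big(\epsilon+\eta^{\min\{1/p,\,1-1/p\}}\big)&\text{if }p>1,\\ O\big(\epsilon+\eta^{1-r}\big)&\text{if }p=1,\end{cases}$$ with the running time complexity of $$\widetilde O\big((\mathsf{Cost}_{k_1,\epsilon}+\mathsf{Cost}_{k_2,\epsilon})\log^2(1/\eta)\big).$$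
   Context: Notation: $[n]=\{1,\dots,n\}$; $\mathcal P(\mathcal Z)$ is the set of Borel probability measures on $\mathcal Z$; $\phi=\frac{\sqrt5-1}2$. In the error bounds, the constants in $O(\cdot)$ depend on the remaining problem data (including $b_i$) but not on $\epsilon,\eta$; $\widetilde O$ suppresses logarithmic factors. Setting. $\mathcal X\subseteq\mathbb R^n$, $\mathcal Z\subseteq\mathbb R^m$. A transportation cost $c:\mathcal Z\times\mathcal Z\to\mathbb R_+$ is lower semicontinuous, satisfies $c(z,z)=0$ for all $z$, and $c(\cdot,\hat z)$ is convex for every fixed $\hat z\in\mathcal Z$. The optimal transport discrepancy is $\mathrm{OT}_c(\mathbb P,\mathbb Q)=\min_{\gamma}\mathbb E_{(z,\hat z)\sim\gamma}[c(z,\hat z)]$ over couplings $\gamma$ of $\mathbb P$ and $\mathbb Q$. Given $\hat z_1,\dots,\hat z_N\in\mathcal Z$, let $\hat{\mathbb P}=\frac1N\sum_{i=1}^N\delta_{\hat z_i}$; given $\rho>0$, let $\mathcal P=\{\mathbb P\in\mathcal P(\mathcal Z):\mathrm{OT}_c(\mathbb P,\hat{\mathbb P})\le\rho\}$. Regularity assumption. (i) $\mathcal X$ is nonempty and convex; there exist $\mathbb Q_0\in\mathcal P$ and $x_0\in\mathcal X$ such that $x\mapsto\mathbb E_{z\sim\mathbb Q_0}[\ell(x,z)]$ is inf-compact on $\mathcal X$ (all sublevel sets are compact) and $\mathbb E_{z\sim\mathbb Q_0}[\ell(x_0,z)]>-\infty$; $\mathcal Z$ is nonempty, closed and convex. (ii)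 $\ell(x,z)=\max_{k\in[K]}\ell_k(x,z)$ with $K\ge2$, where each $\ell_k:\mathbb R^n\times\mathbb R^m\to\mathbb R$ is real-valued, convex in its first and concave in its second argument. (iii) There exist a norm $\|\cdot\|$ on $\mathbb R^m$ and $p\ge1$ with $c(z,\hat z)\ge\|z-\hat z\|^p$ for all $z,\hat z\in\mathcal Z$; moreover, if $p=1$, then for every $x\in\mathcal X$ there exist $g>0$, $\hat z_0\in\mathcal Z$ and $r\in[0,1)$ such that $\ell(x,z)\le g[1+\|z-\hat z_0\|^r]$. Local worst-case oracle assumption. For any $k\in[K]$, $\hat z\in\mathcal Z$, radius $u\ge0$ and accuracy $\epsilon>0$ there is an algorithm, denoted $(\hat L,\hat v)\gets\mathsf{WCO}_k^\epsilon(\hat z,u)$, running in time $\mathsf{Cost}_{k,\epsilon}$ that returns $\hat v\in\mathbb R^m$ with $\hat z+\hat v\in\mathcal Z$, $c(\hat z+\hat v,\hat z)\le u$, together with $\hat L=\ell_k(\hat z+\hat v)$ satisfying $\hat L\ge\max\{\ell_k(\hat z+v):v\in\mathbb R^m,\hat z+v\in\mathcal Z,c(\hat z+v,\hat z)\le u\}-\epsilon$. Pairwise utility. $V_i^{(k_1,k_2)}(b)$ is the maximum of $\alpha_1\ell_{k_1}(\hat z_i+v_1)+\alpha_2\ell_{k_2}(\hat z_i+v_2)$ over $\alpha_j,\beta_j\in\mathbb R_+$, $v_j\in\mathbb R^m$ with $\hat z_i+v_j\in\mathcal Z$, $\alpha_jc(\hat z_i+v_j,\hat z_i)\le\beta_j$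 ($j=1,2$), $\alpha_1+\alpha_2=1$, $\beta_1+\beta_2=b$. Algorithms (both use the same $\eta,\epsilon$). InnerSolver$(i,k_1,k_2,b_i,\alpha_1)$ with $\alpha_1\in(0,1)$: set $\alpha_2=1-\alpha_1$, $L=0$, $U=b_i$, $\beta^{(1)}=U-\phi(U-L)$, $\beta^{(2)}=L+\phi(U-L)$. While $U-L>\eta$: for $j=1,2$ call $(L_1^{(j)},v_1^{(j)})\gets\mathsf{WCO}^\epsilon_{k_1}(\hat z_i,\beta^{(j)}/\alpha_1)$, $(L_2^{(j)},v_2^{(j)})\gets\mathsf{WCO}^\epsilon_{k_2}(\hat z_i,(b_i-\beta^{(j)})/\alpha_2)$ and set $V^{(j)}=\alpha_1L_1^{(j)}+\alpha_2L_2^{(j)}$; if $V^{(1)}<V^{(2)}$, set $L\gets\beta^{(1)}$, $\beta^{(1)}\gets\beta^{(2)}$, $\beta^{(2)}\gets L+\phi(U-L)$; otherwise set $U\gets\beta^{(2)}$, $\beta^{(2)}\gets\beta^{(1)}$, $\beta^{(1)}\gets U-\phi(U-L)$. Finally choose $j^\star\in\arg\max_jV^{(j)}$ and return the value $V^{(j^\star)}$ and the optimizer $(\alpha_1,\alpha_2,\beta^{(j^\star)},b_i-\beta^{(j^\star)},v_1^{(j^\star)},v_2^{(j^\star)})$, where $\beta^{(j^\star)}$ is the point at which $V^{(j^\star)}$ was evaluated. PairEval$(i,k_1,k_2,b_i)$: set $L=0$, $U=1$, $\alpha^{(1)}=U-\phi(U-L)$, $\alpha^{(2)}=L+\phi(U-L)$.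 While $U-L>\eta$: for $j=1,2$ let $(V^{(j)},s^{(j)})$ be the output of InnerSolver$(i,k_1,k_2,b_i,\alpha^{(j)})$; if $V^{(1)}<V^{(2)}$, set $L\gets\alpha^{(1)}$, $\alpha^{(1)}\gets\alpha^{(2)}$, $\alpha^{(2)}\gets L+\phi(U-L)$; otherwise set $U\gets\alpha^{(2)}$, $\alpha^{(2)}\gets\alpha^{(1)}$, $\alpha^{(1)}\gets U-\phi(U-L)$. Finally choose $j^\star\in\arg\max_jV^{(j)}$ and return $\hat V_i^{(k_1,k_2)}(b_i)=V^{(j^\star)}$ and $\hat s=s^{(j^\star)}$.
   Formalization: If a while loop is never entered (b_i ≤ η in InnerSolver, e.g. b_i = 0, or η ≥ 1 in PairEval), the values V^(j) are undefined as written; here the two initial points are evaluated once. The running time bound is for η ≤ η_0, for each η_0 < 1, since log(1/η) vanishes at η = 1. *)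

(* Defs.v *)
From HB Require Import structures.
From mathcomp Require Import all_boot all_order all_algebra.
From mathcomp Require Import all_classical all_reals all_analysis.

Set Implicit Arguments.
Unset Strict Implicit.
Unset Printing Implicit Defensive.

Import Order.TTheory GRing.Theory Num.Theory.
Import numFieldNormedType.Exports.

Local Open Scope classical_set_scope.
Local Open Scope ring_scope.

Definition is_maximum (R : realType) (S : set R) (v : R) : Prop :=
  S v /\ forall w, S w -> w <= v.

Definition is_norm (R : realType) (m : nat) (nrm : 'rV[R]_m -> R) : Prop :=
  [/\ forall v, 0 <= nrm v,
      forall v, nrm v = 0 -> v = 0,
      forall (a : R) v, nrm (a *: v) = `|a| * nrm v &
      forall v w, nrm (v + w) <= nrm v + nrm w].

(* R^m with its Borel sigma-algebra. *)
Notation borelRV R m := (g_sigma_algebraType (@open 'rV[R]_m)).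

Section Transport.
Context {R : realType} {m : nat}.
Implicit Types (Z : set 'rV[R]_m) (c : 'rV[R]_m -> 'rV[R]_m -> R).

(* Only the values of [c] on [Z `*` Z] are constrained; lower semicontinuity is
   with respect to the subspace topology of [Z `*` Z]. *)
Definition transport_cost Z c : Prop :=
  [/\ forall z zh, Z z -> Z zh -> 0 <= c z zh,
      lower_semicontinuous
        (fun w : subspace (Z `*` Z) => (c w.1 w.2)%:E),
      forall z, Z z -> c z z = 0 &
      forall zh, Z zh -> convex_function Z (fun z => c z zh)].

Definition coupling (P Q : set (borelRV R m) -> \bar R)
    (g : probability (borelRV R m * borelRV R m)%type R) : Prop :=
  (forall A : set (borelRV R m), measurable A -> g (A `*` setT) = P A) /\
  (forall B : set (borelRV R m), measurable B -> g (setT `*` B) = Q B).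

Definition OT Z c (P Q : set (borelRV R m) -> \bar R) : \bar R :=
  ereal_inf [set (\int[g]_(w in Z `*` Z) (c w.1 w.2)%:E)%E
            | g in coupling P Q].

Definition empirical (N : nat) (zhat : 'I_N -> 'rV[R]_m)
    (A : set (borelRV R m)) : \bar R :=
  ((N%:R^-1)%:E * \sum_(i < N) \d_(zhat i : borelRV R m) A)%E.

(* Borel probability measures on the closed set [Z] are represented by Borel
   probability measures on R^m giving mass 1 to [Z]. *)
Definition ambiguity_set Z c (N : nat) (zhat : 'I_N -> 'rV[R]_m) (rho : R)
    (Q : probability (borelRV R m) R) : Prop :=
  Q Z = 1%E /\ (OT Z c Q (empirical zhat) <= rho%:E)%E.

End Transport.

Section Regularity.
Context {R : realType} {n m K : nat}.
Implicit Types (X : set 'rV[R]_n) (Z : set 'rV[R]_m).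
Implicit Types (ell : 'I_K -> 'rV[R]_n -> 'rV[R]_m -> R).

(* The maximum is taken in the extended reals so that it needs no default
   value; it is finite as soon as [0 < K]. *)
Definition loss ell (x : 'rV[R]_n) (z : 'rV[R]_m) : \bar R :=
  (\big[maxe/-oo]_(k < K) (ell k x z)%:E)%E.

Definition expected_loss Z ell (Q : probability (borelRV R m) R)
    (x : 'rV[R]_n) : \bar R :=
  (\int[Q]_(z in Z) loss ell x z)%E.

Definition growth_exponent Z ell (nrm : 'rV[R]_m -> R) (x : 'rV[R]_n)
    (r : R) : Prop :=
  0 <= r < 1 /\
  exists (g : R) (z0 : 'rV[R]_m),
    [/\ 0 < g, Z z0 &
        forall z, Z z ->
          (loss ell x z <= (g * (1 + nrm (z - z0) `^ r))%:E)%E].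

Record regularity X Z (c : 'rV[R]_m -> 'rV[R]_m -> R) (N : nat)
    (zhat : 'I_N -> 'rV[R]_m) (rho : R) ell
    (nrm : 'rV[R]_m -> R) (p : R) : Prop := Regularity {
  reg_X_nonempty : X !=set0;
  reg_X_convex : convex_set X;
  reg_inf_compact :
    exists (Q0 : probability (borelRV R m) R) (x0 : 'rV[R]_n),
      [/\ ambiguity_set Z c zhat rho Q0, X x0,
          forall a : R,
            compact [set x | X x /\ (expected_loss Z ell Q0 x <= a%:E)%E] &
          (-oo < expected_loss Z ell Q0 x0)%E];
  reg_Z_nonempty : Z !=set0;
  reg_Z_closed : closed Z;
  reg_Z_convex : convex_set Z;
  reg_K : (2 <= K)%N;
  reg_ell_convex : forall k z, convex_function setT (fun x => ell k x z);
  reg_ell_concave : forall k x, convex_function setT (fun z => - ell k x z);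
  reg_norm : is_norm nrm;
  reg_p : 1 <= p;
  reg_c_norm : forall z zh, Z z -> Z zh -> nrm (z - zh) `^ p <= c z zh;
  reg_growth : p = 1 ->
    forall x, X x -> exists r, growth_exponent Z ell nrm x r
}.

End Regularity.

(* [wco k eps zh u] is the pair (L, v) returned by the oracle,
   [wco_time k eps zh u] the number of steps of that call, which is at least 1:
   the arithmetic surrounding a call is thus within a constant factor of it. *)
Record oracle (R : realType) (m K : nat) := Oracle {
  wco : 'I_K -> R -> 'rV[R]_m -> R -> R * 'rV[R]_m;
  wco_time : 'I_K -> R -> 'rV[R]_m -> R -> nat;
  wco_cost : 'I_K -> R -> nat
}.

Definition oracle_assumption (R : realType) (m K : nat) (Z : set 'rV[R]_m)
    (c : 'rV[R]_m -> 'rV[R]_m -> R) (f : 'I_K -> 'rV[R]_m -> R)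
    (O : oracle R m K) : Prop :=
  forall (k : 'I_K) (zh : 'rV[R]_m) (u eps : R),
    Z zh -> 0 <= u -> 0 < eps ->
    let: (L, v) := wco O k eps zh u in
    [/\ Z (zh + v) /\ c (zh + v) zh <= u,
        L = f k (zh + v),
        forall w, Z (zh + w) -> c (zh + w) zh <= u -> f k (zh + w) - eps <= L &
        (0 < wco_time O k eps zh u <= wco_cost O k eps)%N].

Record pair_point (R : realType) (m : nat) := PairPoint {
  pp_a1 : R; pp_a2 : R; pp_b1 : R; pp_b2 : R;
  pp_v1 : 'rV[R]_m; pp_v2 : 'rV[R]_m
}.

Section PairProblem.
Context {R : realType} {m : nat}.
Variables (Z : set 'rV[R]_m) (c : 'rV[R]_m -> 'rV[R]_m -> R).
Variables (f1 f2 : 'rV[R]_m -> R) (zh : 'rV[R]_m) (b : R).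

Definition pair_feasible (s : pair_point R m) : Prop :=
  let: PairPoint a1 a2 b1 b2 v1 v2 := s in
  [/\ [/\ 0 <= a1, 0 <= a2, 0 <= b1 & 0 <= b2],
      Z (zh + v1) /\ Z (zh + v2),
      a1 * c (zh + v1) zh <= b1 /\ a2 * c (zh + v2) zh <= b2,
      a1 + a2 = 1 & b1 + b2 = b].

Definition pair_objective (s : pair_point R m) : R :=
  pp_a1 s * f1 (zh + pp_v1 s) + pp_a2 s * f2 (zh + pp_v2 s).

Definition pair_values : set R := pair_objective @` pair_feasible.

End PairProblem.

Definition golden (R : realType) : R := (Num.sqrt 5 - 1) / 2.

(* Golden-section search as a big-step relation. [eval x (v, a) t] means that
   evaluating at the point [x] may return the value [v] with the certificate [a]
   after [t] steps. Straight-line arithmetic around the evaluations is charged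
   one step per pass. *)
Section GoldenSection.
Context {R : realType} {A : Type}.
Variables (eval : R -> R * A -> nat -> Prop) (eta : R).
Let phi : R := golden R.

(* [golden_loop L U x1 x2 last (e1, e2) t]: started on the bracket [L, U] with
   interior points [x1], [x2], the loop stops after [t] steps, and [e1], [e2] are
   the evaluations of the last iteration that was executed; [last] holds the
   evaluations of the previous iteration. If the loop body is never executed
   (the initial bracket is already within tolerance), the two initial interior
   points are evaluated once, so that there is a value to return. *)
Inductive golden_loop :
    R -> R -> R -> R -> option ((R * A) * (R * A)) ->
    (R * A) * (R * A) -> nat -> Prop :=
| golden_exit (L U x1 x2 : R) es :
    U - L <= eta -> golden_loop L U x1 x2 (Some es) es 1%N
| golden_exit0 (L U x1 x2 : R) e1 e2 t1 t2 :
    U - L <= eta -> eval x1 e1 t1 -> eval x2 e2 t2 ->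
    golden_loop L U x1 x2 None (e1, e2) (t1 + t2 + 1)%N
| golden_up (L U x1 x2 : R) last e1 e2 t1 t2 es t :
    eta < U - L -> eval x1 e1 t1 -> eval x2 e2 t2 -> e1.1 < e2.1 ->
    golden_loop x1 U x2 (x1 + phi * (U - x1)) (Some (e1, e2)) es t ->
    golden_loop L U x1 x2 last es (t1 + t2 + 1 + t)%N
| golden_down (L U x1 x2 : R) last e1 e2 t1 t2 es t :
    eta < U - L -> eval x1 e1 t1 -> eval x2 e2 t2 -> e2.1 <= e1.1 ->
    golden_loop L x2 (x2 - phi * (x2 - L)) x1 (Some (e1, e2)) es t ->
    golden_loop L U x1 x2 last es (t1 + t2 + 1 + t)%N.

(* Ties in the final arg max may be broken either way. *)
Definition golden_search (L U : R) (e : R * A) (t : nat) : Prop :=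
  exists e1 e2,
    golden_loop L U (U - phi * (U - L)) (L + phi * (U - L)) None (e1, e2) t /\
    ((e = e1 /\ e2.1 <= e1.1) \/ (e = e2 /\ e1.1 <= e2.1)).

End GoldenSection.

Section Algorithms.
Context {R : realType} {m K : nat}.
Variables (O : oracle R m K) (eps eta : R).
Variables (zh : 'rV[R]_m) (k1 k2 : 'I_K) (b : R).

Definition inner_eval (a1 : R) (beta : R) (e : R * pair_point R m)
    (t : nat) : Prop :=
  let a2 := 1 - a1 in
  let u1 := beta / a1 in
  let u2 := (b - beta) / a2 in
  let: (L1, v1) := wco O k1 eps zh u1 in
  let: (L2, v2) := wco O k2 eps zh u2 in
  e = (a1 * L1 + a2 * L2, PairPoint a1 a2 beta (b - beta) v1 v2) /\
  t = (wco_time O k1 eps zh u1 + wco_time O k2 eps zh u2 + 1)%N.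

Definition InnerSolver (a1 : R) : R * pair_point R m -> nat -> Prop :=
  golden_search (inner_eval a1) eta 0 b.

Definition PairEval : R * pair_point R m -> nat -> Prop :=
  golden_search InnerSolver eta 0 1.

End Algorithms.

Definition error_rate (R : realType) (p r : R) : R :=
  if p == 1 then 1 - r else Num.min p^-1 (1 - p^-1).

(* The soft-O of [g]: a multiple of [g] times a power of [log g], written so as
   to be meaningful for small [g]. *)
Definition softO_bound (R : realType) (C : R) (q : nat) (g : R) : R :=
  C * g * (1 + ln (1 + g)) ^+ q.

(* Main.v *)
Require Import Defs.
From HB Require Import structures.
From mathcomp Require Import all_boot all_order all_algebra.
From mathcomp Require Import all_classical all_reals all_analysis.
From mathcomp Require Import ring lra zify.
Import Order.TTheory GRing.Theory Num.Theory.
Import numFieldNormedType.Exports.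
Local Open Scope classical_set_scope.
Local Open Scope ring_scope.

Set Implicit Arguments.
Unset Strict Implicit.
Unset Printing Implicit Defensive.

(** Let F_k(u) be the largest value of the k-th loss over the transport ball of
   radius u around the sample point; it is concave and nondecreasing.  The pair
   problem maximizes a F_1(beta/a) + (1-a) F_2((b-beta)/(1-a)) over a and beta,
   a jointly concave function because perspectives are superadditive and
   homogeneous.  A concave function on a segment has the modulus of continuity it
   has at the two endpoints.  For beta this is the modulus of F_k at 0, of order
   1/p since a finite concave function has an affine majorant at each point.  For
   a it comes from the growth of F_k at infinity: d F_k(b/d) is of order
   d^(1-1/p), or d^(1-r) when p = 1.

   A golden-section search with one-sided noise delta either keeps the maximizer
   in its bracket, so that the modulus bounds the error, or discards it once.  In
   the latter case concavity puts a probed point within 3 delta of the optimum,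
   and the best measured value never decreases afterwards because evaluations
   are reproducible.  The outer search sees the inner error as its noise. *)

(** * Golden-section search *)

Section Golden.
Context {R : realType}.
Implicit Types L U : R.
Local Notation phi := (golden R).

Lemma golden_sqr : phi * phi = 1 - phi.
Proof.
have s5 : Num.sqrt 5 * Num.sqrt 5 = 5 :> R by rewrite -expr2 sqr_sqrtr.
rewrite /golden; lra.
Qed.

Lemma golden_bounds : 3 / 5 <= phi <= 2 / 3.
Proof.
have s5 : Num.sqrt 5 * Num.sqrt 5 = 5 :> R by rewrite -expr2 sqr_sqrtr.
have s0 : 0 <= Num.sqrt 5 :> R by exact: sqrtr_ge0.
rewrite /golden; apply/andP; split; nra.
Qed.

Lemma golden_gt0 : 0 < phi.
Proof. have := golden_bounds; lra. Qed.

(* For b = 0 the inner search runs on the degenerate segment [0, 0]. *)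
Definition interior_pt L0 U0 x := L0 <= x <= U0 /\ (L0 < U0 -> L0 < x < U0).

Definition bracket L0 U0 L U :=
  [/\ L0 <= L, L <= U, U <= U0 & L0 < U0 -> L < U].

Definition lo_pt L U := U - phi * (U - L).
Definition hi_pt L U := L + phi * (U - L).

Lemma golden_mul_bounds L U : L <= U ->
  3 / 5 * (U - L) <= phi * (U - L) <= 2 / 3 * (U - L).
Proof.
have := golden_bounds => /andP[h1 h2] LU; rewrite !ler_wpM2r ?subr_ge0 //.
Qed.

Lemma lo_interior {L0 U0 L U} :
  bracket L0 U0 L U -> interior_pt L0 U0 (lo_pt L U).
Proof.
move=> [a LU c d]; have := golden_mul_bounds LU; rewrite /interior_pt /lo_pt.
by split=> [|/d]; lra.
Qed.

Lemma hi_interior {L0 U0 L U} :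
  bracket L0 U0 L U -> interior_pt L0 U0 (hi_pt L U).
Proof.
move=> [a LU c d]; have := golden_mul_bounds LU; rewrite /interior_pt /hi_pt.
by split=> [|/d]; lra.
Qed.

Lemma bracket_up {L0 U0 L U} :
  bracket L0 U0 L U -> bracket L0 U0 (lo_pt L U) U.
Proof.
move=> [a LU c d]; have := golden_mul_bounds LU; rewrite /bracket /lo_pt.
by split=> [|||/d]; lra.
Qed.

Lemma bracket_down {L0 U0 L U} :
  bracket L0 U0 L U -> bracket L0 U0 L (hi_pt L U).
Proof.
move=> [a LU c d]; have := golden_mul_bounds LU; rewrite /bracket /hi_pt.
by split=> [|||/d]; lra.
Qed.

Lemma lo_pt_up L U : lo_pt (lo_pt L U) U = hi_pt L U.
Proof.
transitivity (U - phi * phi * (U - L)); first by rewrite /lo_pt; ring.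
by rewrite golden_sqr /hi_pt; ring.
Qed.

Lemma hi_pt_down L U : hi_pt L (hi_pt L U) = lo_pt L U.
Proof.
transitivity (L + phi * phi * (U - L)); first by rewrite /hi_pt; ring.
by rewrite golden_sqr /lo_pt; ring.
Qed.

Lemma up_length L U : U - lo_pt L U = phi * (U - L).
Proof. by rewrite /lo_pt; ring. Qed.

Lemma down_length L U : hi_pt L U - L = phi * (U - L).
Proof. by rewrite /hi_pt; ring. Qed.

Lemma shrink_exp (d : R) n : phi * d * phi ^+ n = d * phi ^+ n.+1.
Proof. by rewrite exprS mulrCA mulrA. Qed.

End Golden.

(** The three-point inequality is cleared of denominators, so coinciding points and a degenerate
    segment need no separate treatment. *)
Definition concave_on (R : realType) (a b : R) (h : R -> R) :=
  forall x y z, a <= x -> x <= y -> y <= z -> z <= b ->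
  (z - y) * h x + (y - x) * h z <= (z - x) * h y.

Section GoldenSearchTheory.
Context {R : realType} {A : Type}.
Variables (eval : R -> R * A -> nat -> Prop) (eta : R).
Implicit Types (L U : R) (e : R * A) (es : (R * A) * (R * A)).
Local Notation phi := (golden R).
Local Notation loop L U := (golden_loop eval eta L U (lo_pt L U) (hi_pt L U)).

(* Since phi^2 = 1 - phi, the interior points passed to the recursive calls are
   again the golden points of the shrunken bracket. *)
Lemma golden_loop_bracket_ind
    (P : R -> R -> option ((R * A) * (R * A)) ->
         (R * A) * (R * A) -> nat -> Prop) :
  (forall L U es, U - L <= eta -> P L U (Some es) es 1%N) ->
  (forall L U e1 e2 t1 t2, U - L <= eta ->
     eval (lo_pt L U) e1 t1 -> eval (hi_pt L U) e2 t2 ->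
     P L U None (e1, e2) (t1 + t2 + 1)%N) ->
  (forall L U last e1 e2 t1 t2 es t, eta < U - L ->
     eval (lo_pt L U) e1 t1 -> eval (hi_pt L U) e2 t2 -> e1.1 < e2.1 ->
     loop (lo_pt L U) U (Some (e1, e2)) es t ->
     P (lo_pt L U) U (Some (e1, e2)) es t ->
     P L U last es (t1 + t2 + 1 + t)%N) ->
  (forall L U last e1 e2 t1 t2 es t, eta < U - L ->
     eval (lo_pt L U) e1 t1 -> eval (hi_pt L U) e2 t2 -> e2.1 <= e1.1 ->
     loop L (hi_pt L U) (Some (e1, e2)) es t ->
     P L (hi_pt L U) (Some (e1, e2)) es t ->
     P L U last es (t1 + t2 + 1 + t)%N) ->
  forall L U last es t, loop L U last es t -> P L U last es t.
Proof.
move=> P1 P2 P3 P4 L U last es t.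
suff gen x1 x2 : golden_loop eval eta L U x1 x2 last es t ->
    x1 = lo_pt L U -> x2 = hi_pt L U -> P L U last es t.
  by move=> H; exact: gen H erefl erefl.
elim=> {L U x1 x2 last es t}.
- by move=> L U x1 x2 es LU _ _; exact: P1.
- move=> L U x1 x2 e1 e2 t1 t2 LU ev1 ev2 E1 E2.
  by apply: P2; rewrite -?E1 -?E2.
- move=> L U x1 x2 last e1 e2 t1 t2 es t LU ev1 ev2 e12 H IH E1 E2; subst x1 x2.
  apply: (P3 L U last e1 e2) => //; last by apply: IH; rewrite ?lo_pt_up.
  by rewrite lo_pt_up.
- move=> L U x1 x2 last e1 e2 t1 t2 es t LU ev1 ev2 e12 H IH E1 E2; subst x1 x2.
  apply: (P4 L U last e1 e2) => //; last by apply: IH; rewrite ?hi_pt_down.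
  by rewrite hi_pt_down.
Qed.

Lemma golden_searchE L U e t : golden_search eval eta L U e t <->
  exists e1 e2, loop L U None (e1, e2) t /\
    ((e = e1 /\ e2.1 <= e1.1) \/ (e = e2 /\ e1.1 <= e2.1)).
Proof. by []. Qed.

(** Brackets only shrink, so every probe is an interior point of the initial segment. For the outer
    search this keeps both weights strictly positive. *)
Lemma golden_loop_inv L0 U0 (Q : R * A -> Prop) :
  (forall x e t, interior_pt L0 U0 x -> eval x e t -> Q e) ->
  forall L U last es t, loop L U last es t -> bracket L0 U0 L U ->
  (forall es', last = Some es' -> Q es'.1 /\ Q es'.2) -> Q es.1 /\ Q es.2.
Proof.
move=> evQ; apply: golden_loop_bracket_ind.
- by move=> L U es _ _; apply.
- move=> L U e1 e2 t1 t2 _ ev1 ev2 br _; split.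
    exact: evQ (lo_interior br) ev1.
  exact: evQ (hi_interior br) ev2.
- move=> L U last e1 e2 t1 t2 es t _ ev1 ev2 _ _ IH br _.
  apply: (IH (bracket_up br)) => _ [<-]; split.
    exact: evQ (lo_interior br) ev1.
  exact: evQ (hi_interior br) ev2.
- move=> L U last e1 e2 t1 t2 es t _ ev1 ev2 _ _ IH br _.
  apply: (IH (bracket_down br)) => _ [<-]; split.
    exact: evQ (lo_interior br) ev1.
  exact: evQ (hi_interior br) ev2.
Qed.

Lemma bracket_refl L0 U0 : L0 <= U0 -> bracket L0 U0 L0 U0.
Proof. by split. Qed.

Lemma golden_search_inv L0 U0 (Q : R * A -> Prop) : L0 <= U0 ->
  (forall x e t, interior_pt L0 U0 x -> eval x e t -> Q e) ->
  forall e t, golden_search eval eta L0 U0 e t -> Q e.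
Proof.
move=> LU0 evQ e t /golden_searchE[e1 [e2 [H sel]]].
have [//|Q1 Q2] := golden_loop_inv evQ H (bracket_refl LU0).
by case: sel => -[-> _].
Qed.

Lemma golden_loop_det :
  (forall x e e' t t', eval x e t -> eval x e' t' -> e = e') ->
  forall L U last es t, loop L U last es t ->
  forall es' t', loop L U last es' t' -> es = es'.
Proof.
move=> evF.
(* Inversion of a run at golden points, one alternative per constructor, with the recursive calls
   again in golden form. *)
have inv L U last es t : loop L U last es t ->
    [\/ U - L <= eta /\ last = Some es,
        [/\ U - L <= eta, last = None & exists t1 t2,
          eval (lo_pt L U) es.1 t1 /\ eval (hi_pt L U) es.2 t2],
        eta < U - L /\ exists e1 e2 t1 t2 t', [/\ eval (lo_pt L U) e1 t1,
          eval (hi_pt L U) e2 t2, e1.1 < e2.1 &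
          loop (lo_pt L U) U (Some (e1, e2)) es t'] |
        eta < U - L /\ exists e1 e2 t1 t2 t', [/\ eval (lo_pt L U) e1 t1,
          eval (hi_pt L U) e2 t2, e2.1 <= e1.1 &
          loop L (hi_pt L U) (Some (e1, e2)) es t']].
  move: L U last es t; apply: golden_loop_bracket_ind.
  - by move=> L U es LU; constructor 1.
  - by move=> L U e1 e2 t1 t2 LU ev1 ev2; constructor 2; split=> //; exists t1, t2.
  - move=> L U last e1 e2 t1 t2 es t LU ev1 ev2 e12 H _; constructor 3.
    by split=> //; exists e1, e2, t1, t2, t.
  - move=> L U last e1 e2 t1 t2 es t LU ev1 ev2 e12 H _; constructor 4.
    by split=> //; exists e1, e2, t1, t2, t.
apply: golden_loop_bracket_ind.
- by move=> L U es LU es' t' /inv[[_ [->]]|[]|[]|[]] //; rewrite ltNge LU.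
- move=> L U e1 e2 t1 t2 LU ev1 ev2 [e1' e2'] t' /inv[[_ //]|[_ _]|[]|[]];
    try by rewrite ltNge LU.
  by move=> [s1 [s2 [/= /(evF _ _ _ _ _ ev1) -> /(evF _ _ _ _ _ ev2) ->]]].
- move=> L U last e1 e2 t1 t2 es t LU ev1 ev2 e12 _ IH es' t'.
  move=> /inv[[]|[]|[_]|[_]]; try by rewrite leNgt LU.
    move=> [e1' [e2' [s1 [s2 [s]]]]] [].
    by move=> /(evF _ _ _ _ _ ev1) <- /(evF _ _ _ _ _ ev2) <- _ /IH.
  move=> [e1' [e2' [s1 [s2 [s]]]]] [].
  move=> /(evF _ _ _ _ _ ev1) <- /(evF _ _ _ _ _ ev2) <-.
  by rewrite leNgt e12.
- move=> L U last e1 e2 t1 t2 es t LU ev1 ev2 e12 _ IH es' t'.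
  move=> /inv[[]|[]|[_]|[_]]; try by rewrite leNgt LU.
    move=> [e1' [e2' [s1 [s2 [s]]]]] [].
    move=> /(evF _ _ _ _ _ ev1) <- /(evF _ _ _ _ _ ev2) <-.
    by rewrite ltNge e12.
  move=> [e1' [e2' [s1 [s2 [s]]]]] [].
  by move=> /(evF _ _ _ _ _ ev1) <- /(evF _ _ _ _ _ ev2) <- _ /IH.
Qed.

(** Only the value is determined: on a tie either certificate may be returned. *)
Lemma golden_search_det L U :
  (forall x e e' t t', eval x e t -> eval x e' t' -> e = e') ->
  forall e e' t t', golden_search eval eta L U e t ->
  golden_search eval eta L U e' t' -> e.1 = e'.1.
Proof.
move=> evF e e' t t' /golden_searchE[e1 [e2 [H sel]]].
move=> /golden_searchE[e1' [e2' [H' sel']]].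
have [E1 E2] := golden_loop_det evF H H'; subst e1' e2'.
by case: sel => -[-> le1]; case: sel' => -[-> le2] //;
  apply/eqP; rewrite eq_le le1 le2.
Qed.

(** The exponent [n] serves as fuel, since each pass multiplies the bracket length by [phi]. *)
Lemma golden_loop_total :
  (forall x, exists e t, eval x e t) ->
  forall n L U last, (U - L) * phi ^+ n <= eta ->
  exists es t, loop L U last es t.
Proof.
move=> evT; elim=> [|n IH] L U last small.
  rewrite expr0 mulr1 in small; case: last => [es|].
    by exists es, 1%N; constructor.
  have [[e1 [t1 ev1]] [e2 [t2 ev2]]] := (evT (lo_pt L U), evT (hi_pt L U)).
  by exists (e1, e2), (t1 + t2 + 1)%N; constructor.
have [LU|LU] := leP (U - L) eta.
  case: last => [es|]; first by exists es, 1%N; constructor.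
  have [[e1 [t1 ev1]] [e2 [t2 ev2]]] := (evT (lo_pt L U), evT (hi_pt L U)).
  by exists (e1, e2), (t1 + t2 + 1)%N; constructor.
have [[e1 [t1 ev1]] [e2 [t2 ev2]]] := (evT (lo_pt L U), evT (hi_pt L U)).
have [e12|e21] := ltP e1.1 e2.1.
  have [|es [t H]] := IH (lo_pt L U) U (Some (e1, e2)).
    by rewrite up_length shrink_exp.
  exists es, (t1 + t2 + 1 + t)%N; apply: golden_up ev1 ev2 e12 _ => //.
  by move: H; rewrite lo_pt_up.
have [|es [t H]] := IH L (hi_pt L U) (Some (e1, e2)).
  by rewrite down_length shrink_exp.
exists es, (t1 + t2 + 1 + t)%N; apply: golden_down ev1 ev2 e21 _ => //.
by move: H; rewrite hi_pt_down.
Qed.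

Lemma golden_search_total n L U :
  (forall x, exists e t, eval x e t) -> (U - L) * phi ^+ n <= eta ->
  exists e t, golden_search eval eta L U e t.
Proof.
move=> evT small.
have [[e1 e2] [t H]] := golden_loop_total evT None small.
have [e12|e21] := leP e1.1 e2.1.
  by exists e2, t; apply/golden_searchE; exists e1, e2; split; [|right].
exists e1, t; apply/golden_searchE; exists e1, e2; split=> //.
by left; split=> //; exact: ltW.
Qed.

(** A pass costs two evaluations and one step. At [n = 0] the length bound contradicts
    [eta < U - L]; the extra unit in [n.+1] pays for the exit, which may evaluate the two initial
    points. *)
Lemma golden_loop_time L0 U0 T :
  (forall x e t, interior_pt L0 U0 x -> eval x e t -> (t <= T)%N) ->
  forall L U last es t, loop L U last es t -> bracket L0 U0 L U ->
  forall n, (U - L) * phi ^+ n <= eta -> (t <= (2 * T + 1) * n.+1)%N.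
Proof.
move=> evT; apply: golden_loop_bracket_ind.
- by move=> L U es _ _ n _; nia.
- move=> L U e1 e2 t1 t2 _ ev1 ev2 br n _.
  have := evT _ _ _ (lo_interior br) ev1.
  have := evT _ _ _ (hi_interior br) ev2.
  nia.
- move=> L U last e1 e2 t1 t2 es t LU ev1 ev2 _ _ IH br [|n small]; first lra.
  have := evT _ _ _ (lo_interior br) ev1.
  have := evT _ _ _ (hi_interior br) ev2.
  have := IH (bracket_up br) n.
  rewrite up_length shrink_exp => /(_ small); nia.
- move=> L U last e1 e2 t1 t2 es t LU ev1 ev2 _ _ IH br [|n small]; first lra.
  have := evT _ _ _ (lo_interior br) ev1.
  have := evT _ _ _ (hi_interior br) ev2.
  have := IH (bracket_down br) n.
  rewrite down_length shrink_exp => /(_ small); nia.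
Qed.

Lemma golden_search_time L0 U0 T n : L0 <= U0 ->
  (forall x e t, interior_pt L0 U0 x -> eval x e t -> (t <= T)%N) ->
  (U0 - L0) * phi ^+ n <= eta ->
  forall e t, golden_search eval eta L0 U0 e t -> (t <= (2 * T + 1) * n.+1)%N.
Proof.
move=> LU0 evT small e t /golden_searchE[e1 [e2 [H _]]].
exact: (golden_loop_time evT H (bracket_refl LU0) small).
Qed.

(** * Error of the search under one-sided evaluation noise *)

Section Error.
Variables (L0 U0 : R) (h : R -> R) (xs delta omega : R).
Hypothesis LU0 : L0 <= U0.
Hypothesis h_concave : concave_on L0 U0 h.
Hypothesis xs_in : L0 <= xs <= U0.
Hypothesis xs_max : forall x, L0 <= x <= U0 -> h x <= h xs.
Hypothesis delta_ge0 : 0 <= delta.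
Hypothesis eval_noise : forall x e t, interior_pt L0 U0 x -> eval x e t ->
  h x - delta <= e.1 <= h x.
Hypothesis eval_det : forall x e e' t t', interior_pt L0 U0 x ->
  eval x e t -> eval x e' t' -> e.1 = e'.1.
Hypothesis h_modulus : forall x, L0 <= x <= U0 -> phi * `|x - xs| <= eta ->
  h xs - h x <= omega.

Let good e := h xs - 3 * delta - omega <= e.1.
(** Such a point stands in for a maximizer that has left the bracket: probing it again returns a
    near-optimal value, whatever the tolerance. *)
Let sure x := forall e t, eval x e t -> h xs - 3 * delta <= e.1.

Let omega_ge0 : eta < 0 \/ 0 <= omega.
Proof.
have [|eta0] := ltP eta 0; first by left.
by right; have := h_modulus xs_in; rewrite !subrr normr0 mulr0 => /(_ eta0).
Qed.

(* A comparison can discard the maximizer only if the two values agree up to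
   the noise; by concavity the maximum is then within 2 delta of them. *)
Let wrong_up L U : bracket L0 U0 L U -> L <= xs -> xs <= lo_pt L U ->
  h (lo_pt L U) - delta <= h (hi_pt L U) -> h xs - 2 * delta <= h (lo_pt L U).
Proof.
move=> [L0L LU UU0 _] Lxs xsx.
have /andP[g1 g2] := golden_mul_bounds LU.
have [E|neLU] := eqVneq L U.
  have -> : lo_pt L U = xs by move: xsx; rewrite /lo_pt E subrr mulr0 subr0; lra.
  by move=> _; rewrite lerBlDr lerDl mulr_ge0.
have {neLU}LU' : L < U by rewrite lt_neqAle neLU.
have := @h_concave xs (lo_pt L U) (hi_pt L U).
have := xs_max (x := lo_pt L U).
move: xsx; rewrite /lo_pt /hi_pt.
have /andP[] := golden_bounds (R := R) => p1 p2.
set x1 := U - phi * (U - L); set x2 := L + phi * (U - L) => xsx1.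
(* In units of the bracket length this reads 1 - phi <= 2 (2 phi - 1), that is phi >= 3/5. It bounds
   the extrapolation factor from the two probes to the maximizer, hence the loss by 2 delta. *)
have d1 : x1 - L <= 2 * (x2 - x1) by rewrite /x1 /x2; lra.
have d2 : 0 < x2 - x1 by rewrite /x1 /x2; lra.
have x1b : L0 <= x1 <= U0 by rewrite /x1; lra.
have x2U : x2 <= U0 by rewrite /x2; lra.
move=> /(_ x1b) m /(_ _ xsx1 _ x2U) c3 e12.
have {}c3 : (x2 - x1) * h xs + (x1 - xs) * h x2 <= (x2 - xs) * h x1.
  by apply: c3; lra.
rewrite -(ler_pM2l d2).
have : (x1 - xs) * (h x1 - delta) <= (x1 - xs) * h x2 by rewrite ler_wpM2l //; lra.
have : (x1 - xs) * delta <= 2 * (x2 - x1) * delta by rewrite ler_wpM2r //; lra.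
nra.
Qed.

Let wrong_down L U : bracket L0 U0 L U -> xs <= U -> hi_pt L U <= xs ->
  h (hi_pt L U) - delta <= h (lo_pt L U) -> h xs - 2 * delta <= h (hi_pt L U).
Proof.
move=> [L0L LU UU0 _] xsU xsx.
have /andP[g1 g2] := golden_mul_bounds LU.
have [E|neLU] := eqVneq L U.
  have -> : hi_pt L U = xs by move: xsx; rewrite /hi_pt E subrr mulr0 addr0; lra.
  by move=> _; rewrite lerBlDr lerDl mulr_ge0.
have {neLU}LU' : L < U by rewrite lt_neqAle neLU.
have := @h_concave (lo_pt L U) (hi_pt L U) xs.
have := xs_max (x := hi_pt L U).
move: xsx; rewrite /lo_pt /hi_pt.
have /andP[] := golden_bounds (R := R) => p1 p2.
set x1 := U - phi * (U - L); set x2 := L + phi * (U - L) => xsx2.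
have d1 : U - x2 <= 2 * (x2 - x1) by rewrite /x1 /x2; lra.
have d2 : 0 < x2 - x1 by rewrite /x1 /x2; lra.
have x2b : L0 <= x2 <= U0 by rewrite /x2; lra.
have x1L : L0 <= x1 by rewrite /x1; lra.
move=> /(_ x2b) m /(_ x1L _ xsx2) c3 e12.
have {}c3 : (xs - x2) * h x1 + (x2 - x1) * h xs <= (xs - x1) * h x2.
  by apply: c3; lra.
rewrite -(ler_pM2l d2).
have : (xs - x2) * (h x2 - delta) <= (xs - x2) * h x1 by rewrite ler_wpM2l //; lra.
have : (xs - x2) * delta <= 2 * (x2 - x1) * delta by rewrite ler_wpM2r //; lra.
nra.
Qed.

(** The invariant is that the bracket still contains the maximizer or one of its golden points is
    [sure]. The better probe of a pass is a golden point of the next bracket, so a [sure] point is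
    succeeded by another one. The conditions on [last] cover a loop that stops at once. *)
Lemma golden_loop_error L U last es t : loop L U last es t ->
  0 <= eta -> bracket L0 U0 L U ->
  [\/ L <= xs <= U, sure (lo_pt L U) | sure (hi_pt L U)] ->
  (last = None -> L <= xs <= U) ->
  (forall e1 e2, last = Some (e1, e2) -> U - L <= eta -> good e1 \/ good e2) ->
  good es.1 \/ good es.2.
Proof.
have /andP[p1 p2] := golden_bounds (R := R).
have noise_lo L' U' e t' : bracket L0 U0 L' U' -> eval (lo_pt L' U') e t' ->
    h (lo_pt L' U') - delta <= e.1 <= h (lo_pt L' U').
  by move=> /lo_interior; exact: eval_noise.
have noise_hi L' U' e t' : bracket L0 U0 L' U' -> eval (hi_pt L' U') e t' ->
    h (hi_pt L' U') - delta <= e.1 <= h (hi_pt L' U').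
  by move=> /hi_interior; exact: eval_noise.
move: L U last es t; apply: golden_loop_bracket_ind.
- by move=> L U [e1 e2] LU _ _ _ _; apply.
- move=> L U e1 e2 t1 t2 LU ev1 _ eta0 br _ /(_ erefl) xsLU _; left.
  have := noise_lo _ _ _ _ br ev1.
  have [x1b _] := lo_interior br.
  have := h_modulus x1b.
  have : phi * `|lo_pt L U - xs| <= eta.
    have : `|lo_pt L U - xs| <= U - L.
      case: br => _ /golden_mul_bounds; rewrite /lo_pt ler_norml; lra.
    have := normr_ge0 (lo_pt L U - xs); nra.
  move=> /[swap] /[apply]; rewrite /good; lra.
- move=> L U last e1 e2 t1 t2 es t LU ev1 ev2 e12 _ IH eta0 br inv _ _.
  have n1 := noise_lo _ _ _ _ br ev1; have n2 := noise_hi _ _ _ _ br ev2.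
  have w0 : 0 <= omega by case: omega_ge0 => //; lra.
  (* The upper probe becomes the lower golden point of the new bracket, where reproducibility
     returns the same value. *)
  have caseB : h xs - 3 * delta <= e2.1 -> good es.1 \/ good es.2.
    move=> g2; apply: IH => //; first exact: bracket_up.
      constructor 2; rewrite lo_pt_up => e t'.
      by move=> /(eval_det (hi_interior br) ev2) <-.
    by move=> _ _ [<- <-] _; right; rewrite /good; lra.
  case: inv => [xsLU|s1|s2].
  + have [x1xs|xsx1] := leP (lo_pt L U) xs.
      apply: IH => //; [exact: bracket_up|by constructor 1; lra|].
      (* If this was the final pass, only the new length [phi * (U - L)] is within tolerance, while
         probe and maximizer lie in the old bracket; hence the factor [phi] in [h_modulus]. *)
      move=> _ _ [<- <-]; rewrite up_length => small; right.
      have [x2b _] := hi_interior br.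
      have := h_modulus x2b.
      have : phi * `|hi_pt L U - xs| <= eta.
        apply: le_trans small; rewrite ler_wpM2l ?(ltW golden_gt0) //.
        case: br => _ /golden_mul_bounds; rewrite /hi_pt ler_norml; lra.
      move=> /[swap] /[apply]; rewrite /good; lra.
    (* The maximizer is discarded: 2 delta from the wrong comparison and delta from the noise of the
       measured value make 3 delta. *)
    apply: caseB; have := wrong_up br; lra.
  + by apply: caseB; have := s1 _ _ ev1; lra.
  + by apply: caseB; have := s2 _ _ ev2; lra.
- move=> L U last e1 e2 t1 t2 es t LU ev1 ev2 e12 _ IH eta0 br inv _ _.
  have n1 := noise_lo _ _ _ _ br ev1; have n2 := noise_hi _ _ _ _ br ev2.
  have w0 : 0 <= omega by case: omega_ge0 => //; lra.
  have caseB : h xs - 3 * delta <= e1.1 -> good es.1 \/ good es.2.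
    move=> g2; apply: IH => //; first exact: bracket_down.
      constructor 3; rewrite hi_pt_down => e t'.
      by move=> /(eval_det (lo_interior br) ev1) <-.
    by move=> _ _ [<- <-] _; left; rewrite /good; lra.
  case: inv => [xsLU|s1|s2].
  + have [x1xs|xsx1] := leP xs (hi_pt L U).
      apply: IH => //; [exact: bracket_down|by constructor 1; lra|].
      move=> _ _ [<- <-]; rewrite down_length => small; left.
      have [x1b _] := lo_interior br.
      have := h_modulus x1b.
      have : phi * `|lo_pt L U - xs| <= eta.
        apply: le_trans small; rewrite ler_wpM2l ?(ltW golden_gt0) //.
        case: br => _ /golden_mul_bounds; rewrite /lo_pt ler_norml; lra.
      move=> /[swap] /[apply]; rewrite /good; lra.
    apply: caseB; have := wrong_down br; lra.
  + by apply: caseB; have := s1 _ _ ev1; lra.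
  + by apply: caseB; have := s2 _ _ ev2; lra.
Qed.

Lemma golden_search_error e t : 0 <= eta ->
  golden_search eval eta L0 U0 e t -> h xs - 3 * delta - omega <= e.1.
Proof.
move=> eta0 /golden_searchE[e1 [e2 [H sel]]].
have [|||g1|g2] // := golden_loop_error H eta0 (bracket_refl LU0).
- by constructor 1.
- case: sel => -[-> le12] //; exact: le_trans le12.
- case: sel => -[-> le12] //; exact: le_trans le12.
Qed.

End Error.

End GoldenSearchTheory.

(** * Concave functions on a segment and perspectives *)

Section ConcaveModulus.
Context {R : realType}.
Implicit Types a b d e s t u v w x y z be : R.
Variables (a b : R) (h : R -> R).
Hypothesis h_concave : concave_on a b h.

(** The points [y] and [x + d] lie between [x] and [y + d] and have the same sum, so the two chord
    inequalities add up to the claim. *)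
Lemma concave_increment x y d : a <= x -> x <= y -> 0 <= d -> y + d <= b ->
  h (y + d) - h y <= h (x + d) - h x.
Proof.
move=> ax xy d0 yb.
have [E|ne] := eqVneq (y + d) x.
  by have [-> ->] : y = x /\ d = 0 by lra.
have pos : 0 < y + d - x by rewrite subr_gt0 lt_neqAle eq_sym ne /=; lra.
have c1 : (y + d - y) * h x + (y - x) * h (y + d) <= (y + d - x) * h y.
  by apply: h_concave; lra.
have c2 : (y + d - (x + d)) * h x + (x + d - x) * h (y + d)
    <= (y + d - x) * h (x + d) by apply: h_concave; lra.
have : (y + d - x) * (h x + h (y + d)) <= (y + d - x) * (h y + h (x + d)) by nra.
rewrite ler_pM2l //; lra.
Qed.

Variables (C e : R).
Hypothesis C_ge0 : 0 <= C.
Hypothesis e_gt0 : 0 < e.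
Hypothesis h_left : forall d, 0 <= d <= b - a -> h (a + d) - h a <= C * d `^ e.
Hypothesis h_right : forall d, 0 <= d <= b - a -> h (b - d) - h b <= C * d `^ e.

(** By decreasing increments, a rise over a given length is largest at the left end and a drop is
    largest at the right end. *)
Lemma concave_holder x y : a <= x <= b -> a <= y <= b ->
  h x - h y <= C * `|x - y| `^ e.
Proof.
move=> xab yab; have [yx|xy] := leP y x.
  rewrite ger0_norm ?subr_ge0 //.
  have := @concave_increment a y (x - y).
  have := h_left (d := x - y).
  by rewrite [y + _]addrC subrK => l1 l2; apply: le_trans (l2 _ _ _ _) (l1 _); lra.
rewrite distrC ger0_norm ?subr_ge0 ?(ltW xy) //.
have := @concave_increment x (b - (y - x)) (y - x).
have := h_right (d := y - x).
rewrite [x + _]addrC !subrK => l1 l2.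
have /l1 {}l1 : 0 <= y - x <= b - a by lra.
have : h b - h (b - (y - x)) <= h y - h x by apply: l2; lra.
lra.
Qed.

Lemma concave_argmax : a <= b ->
  exists2 xs, a <= xs <= b & forall x, a <= x <= b -> h x <= h xs.
Proof.
move=> ab; have C1 : 0 < C + 1 by rewrite ltr_wpDl.
have [|xs xsab xsmax] := @EVT_max R h a b ab.
  apply/subspace_continuousP => x; rewrite /= in_itv /= => xab.
  apply/cvgrPdist_le => eps eps0; rewrite near_withinE.
  (* This radius d solves (C + 1) d^e = eps; the added 1 covers [C = 0]. *)
  have d0 : 0 < (eps / (C + 1)) `^ e^-1 by rewrite powR_gt0 ?divr_gt0.
  apply/nbhs_ballP; exists ((eps / (C + 1)) `^ e^-1) => //= y xy.
  rewrite in_itv /= => yab.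
  have le1 : C * `|x - y| `^ e <= eps.
    have : `|x - y| `^ e <= ((eps / (C + 1)) `^ e^-1) `^ e.
      apply: ge0_ler_powR; rewrite ?(ltW e_gt0) ?nnegrE ?(ltW d0) //.
      exact: ltW.
    rewrite -powRrM mulVf ?gt_eqF // powRr1; last by rewrite divr_ge0 ?ltW.
    move=> le; apply: (le_trans (ler_wpM2l C_ge0 le)).
    by rewrite mulrA ler_pdivrMr // mulrDr mulr1 [C * _]mulrC lerDl ltW.
  have := concave_holder xab yab; have := concave_holder yab xab.
  rewrite [`|y - x|]distrC => h1 h2.
  by rewrite ler_norml lerNl opprB (le_trans h1 le1) (le_trans h2 le1).
exists xs; first by rewrite in_itv in xsab.
by move=> x xab; apply: xsmax; rewrite in_itv.
Qed.

End ConcaveModulus.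

(* At [a = 0] division by zero gives [0 * F 0 = 0], the value wanted there. *)
Definition persp (R : realType) (F : R -> R) (a b : R) := a * F (b / a).

(** * Perspectives of concave nondecreasing functions *)

Section Perspective.
Context {R : realType}.
Implicit Types a b d e s t u v w x y z be : R.
Variable F : R -> R.
Hypothesis F_mono : forall u v, 0 <= u -> u <= v -> F u <= F v.
Hypothesis F_concave : forall u v s t, 0 <= u -> 0 <= v -> 0 <= s -> 0 <= t ->
  s + t = 1 -> s * F u + t * F v <= F (s * u + t * v).

Lemma persp0 b : persp F 0 b = 0. Proof. by rewrite /persp mul0r. Qed.

Lemma persp1 b : persp F 1 b = F b. Proof. by rewrite /persp mul1r divr1. Qed.

Lemma persp_homog s a b : persp F (s * a) (s * b) = s * persp F a b.
Proof.
rewrite /persp; have [->|s0] := eqVneq s 0; first by rewrite !mul0r.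
by rewrite -mulrA -mulf_div divff // mul1r.
Qed.

Lemma persp_mono a b b' : 0 <= a -> 0 <= b -> b <= b' ->
  persp F a b <= persp F a b'.
Proof.
move=> a0 b0 bb'; rewrite /persp ler_wpM2l // F_mono ?divr_ge0 //.
by rewrite ler_wpM2r ?invr_ge0.
Qed.

(** For positive weights this is concavity with coefficients a / (a + a') and a' / (a + a'). A zero
    weight contributes nothing, and its budget passes to the other term by monotonicity. *)
Lemma persp_superadd a a' b b' : 0 <= a -> 0 <= a' -> 0 <= b -> 0 <= b' ->
  persp F a b + persp F a' b' <= persp F (a + a') (b + b').
Proof.
move=> a0 a'0 b0 b'0.
have [->|aN0] := eqVneq a 0.
  by rewrite persp0 !add0r persp_mono //; lra.
have [->|a'N0] := eqVneq a' 0.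
  by rewrite persp0 !addr0 persp_mono //; lra.
have ap : 0 < a by rewrite lt_neqAle eq_sym aN0.
have a'p : 0 < a' by rewrite lt_neqAle eq_sym a'N0.
have sp : 0 < a + a' by lra.
have := @F_concave (b / a) (b' / a') (a / (a + a')) (a' / (a + a')).
have -> : a / (a + a') * (b / a) + a' / (a + a') * (b' / a')
    = (b + b') / (a + a') by field; lra.
move=> Fc; rewrite /persp.
have /Fc : 0 <= b / a by rewrite divr_ge0.
rewrite !divr_ge0 ?(ltW sp) // => /(_ isT isT isT) {}Fc.
have {}Fc := Fc ltac:(by field; lra).
rewrite -[leLHS](_ : (a + a') * (a / (a + a') * F (b / a) +
    a' / (a + a') * F (b' / a')) = _); last by field; lra.
by rewrite ler_pM2l.
Qed.

(** The weight enters through the factor a (1/a)^q, which is at most 1 because a <= 1 and q <= 1;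
    the bound is thus uniform in the weight. *)
Lemma persp_holder G q a d : 0 <= G -> q <= 1 ->
  (forall u, 0 <= u -> F u - F 0 <= G * u `^ q) ->
  0 <= a <= 1 -> 0 <= d -> persp F a d - persp F a 0 <= G * d `^ q.
Proof.
move=> G0 q1 FG /andP[a0 a1] d0.
have [->|aN0] := eqVneq a 0.
  by rewrite !persp0 subrr mulr_ge0 ?powR_ge0.
have ap : 0 < a by rewrite lt_neqAle eq_sym aN0.
rewrite /persp mul0r -mulrBr.
have /FG : 0 <= d / a by rewrite divr_ge0.
move=> /(ler_wpM2l a0) /le_trans; apply.
rewrite powRM ?invr_ge0 // mulrCA ler_wpM2l // mulrCA ler_piMr ?powR_ge0 //.
rewrite -(divff aN0) ler_wpM2l // ler1_powR //.
by rewrite invf_ge1.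
Qed.

(** One has d (b/d)^s = b^s d^(1-s), and both d and d^(1-s) are at most d^e on the unit interval. *)
Lemma persp_growth A s e b d : 0 <= A -> 0 <= s -> 0 < e -> e <= 1 - s ->
  (forall u, 0 <= u -> F u <= A * (1 + u `^ s)) ->
  0 <= b -> 0 <= d <= 1 -> persp F d b <= A * (1 + b `^ s) * d `^ e.
Proof.
move=> A0 s0 e0 es FA b0 /andP[d0 d1].
have [->|dN0] := eqVneq d 0.
  by rewrite persp0 !mulr_ge0 ?addr_ge0 ?powR_ge0.
have dp : 0 < d by rewrite lt_neqAle eq_sym dN0.
have /FA : 0 <= b / d by rewrite divr_ge0.
move=> /(ler_wpM2l d0) /le_trans; apply.
rewrite powRM ?invr_ge0 // mulrCA -mulrA ler_wpM2l //.
rewrite mulrDr mulr1 mulrDl mul1r lerD //.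
  by rewrite ger1_powR ?dp //; lra.
rewrite mulrCA ler_wpM2l ?powR_ge0 //.
rewrite -[X in X * _](powRr1 d0) -(powR_inv1 d0) -powRrM -powRD ?dN0 ?implybT //.
by rewrite ger_powR ?dp //; lra.
Qed.

End Perspective.

(** The pair objective after the displacements have been optimized out, as a function of the first
    weight and the first budget. *)
Definition pair_value (R : realType) (F1 F2 : R -> R) (b a be : R) :=
  persp F1 a be + persp F2 (1 - a) (b - be).

(** * Modulus of continuity in the weight near an endpoint *)

Section OuterModulus.
Context {R : realType}.
Implicit Types a b d e s t u v w x y z be : R.
Variables (F1 F2 : R -> R) (b : R) (A s e : R).
Hypothesis b_ge0 : 0 <= b.
Hypothesis F1_mono : forall u v, 0 <= u -> u <= v -> F1 u <= F1 v.
Hypothesis F2_mono : forall u v, 0 <= u -> u <= v -> F2 u <= F2 v.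
Hypothesis F2_concave : forall u v s t, 0 <= u -> 0 <= v -> 0 <= s -> 0 <= t ->
  s + t = 1 -> s * F2 u + t * F2 v <= F2 (s * u + t * v).
Hypotheses (A_ge0 : 0 <= A) (e_gt0 : 0 < e) (s_ge0 : 0 <= s) (es : e <= 1 - s).
Hypothesis F1_growth : forall u, 0 <= u -> F1 u <= A * (1 + u `^ s).

(** The first loss has weight [d] and gains at most order d^e by its growth bound. For the second,
    superadditivity supplies the missing weight [d] at zero budget, at a cost of at most d times |F2
    0|. *)
Lemma pair_value_near_endpoint d be : 0 <= d <= 1 -> 0 <= be <= b ->
  pair_value F1 F2 b d be - F2 b <= (A * (1 + b `^ s) + `|F2 0|) * d `^ e.
Proof.
move=> d01 beb; rewrite /pair_value.
have h1 := persp_growth A_ge0 s_ge0 e_gt0 es F1_growth b_ge0 d01.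
have h2 : persp F1 d be <= persp F1 d b by apply: persp_mono => //; lra.
have h3 : persp F2 (1 - d) (b - be) + persp F2 d 0 <= persp F2 1 (b - be).
  have := persp_superadd F2_mono F2_concave (a := 1 - d) (a' := d)
    (b := b - be) (b' := 0).
  by rewrite subrK addr0; apply; lra.
have h4 : F2 (b - be) <= F2 b by apply: F2_mono; lra.
have h5 : - (`|F2 0| * d `^ e) <= persp F2 d 0.
  rewrite /persp mul0r lerNl -mulrN.
  have : - F2 0 <= `|F2 0| by rewrite -normrN ler_norm.
  have : d <= d `^ e.
    have [->|dN0] := eqVneq d 0; first by rewrite powR_ge0.
    have dp : 0 < d by rewrite lt_neqAle eq_sym dN0 /=; lra.
    have e1 : e <= 1 by move: s_ge0 es; lra.
    by apply: ger1_powR => //; lra.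
  have := normr_ge0 (F2 0); have : 0 <= d by lra.
  move=> d0 n0 de F0; apply: (le_trans (ler_wpM2l d0 F0)).
  by rewrite mulrC ler_wpM2l.
move: h3; rewrite persp1; lra.
Qed.

End OuterModulus.

(** Exchanging the two losses carries the estimate at weight 0 over to weight 1. *)
Lemma pair_value_swap (R : realType) (F1 F2 : R -> R) (b a be : R) :
  pair_value F2 F1 b (1 - a) (b - be) = pair_value F1 F2 b a be.
Proof.
by rewrite /pair_value addrC; congr (persp _ _ _ + _); lra.
Qed.

(** * Concavity and Hölder continuity of the pair value and of its partial maximum *)

Section PairValue.
Context {R : realType}.
Implicit Types a b d e s t u v w x y z be : R.
Variables (F1 F2 : R -> R) (b : R).

Variables (G A q s e : R).
Local Notation pair_value := (pair_value F1 F2 b).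
Hypothesis b_ge0 : 0 <= b.
Hypothesis F1_mono : forall u v, 0 <= u -> u <= v -> F1 u <= F1 v.
Hypothesis F2_mono : forall u v, 0 <= u -> u <= v -> F2 u <= F2 v.
Hypothesis F1_concave : forall u v s t, 0 <= u -> 0 <= v -> 0 <= s -> 0 <= t ->
  s + t = 1 -> s * F1 u + t * F1 v <= F1 (s * u + t * v).
Hypothesis F2_concave : forall u v s t, 0 <= u -> 0 <= v -> 0 <= s -> 0 <= t ->
  s + t = 1 -> s * F2 u + t * F2 v <= F2 (s * u + t * v).
Hypotheses (G_ge0 : 0 <= G) (A_ge0 : 0 <= A).
Hypotheses (e_gt0 : 0 < e) (e_le_q : e <= q) (q1 : q <= 1).
Hypotheses (s_ge0 : 0 <= s) (es : e <= 1 - s).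
Hypothesis F1_holder : forall u, 0 <= u -> F1 u - F1 0 <= G * u `^ q.
Hypothesis F2_holder : forall u, 0 <= u -> F2 u - F2 0 <= G * u `^ q.
Hypothesis F1_growth : forall u, 0 <= u -> F1 u <= A * (1 + u `^ s).
Hypothesis F2_growth : forall u, 0 <= u -> F2 u <= A * (1 + u `^ s).

(** Homogeneity moves the coefficients inside the perspectives, and superadditivity then applies to
    each loss. *)
Lemma pair_value_concave2 x z u v s' t : 0 <= x <= 1 -> 0 <= z <= 1 ->
  0 <= u <= b -> 0 <= v <= b -> 0 <= s' -> 0 <= t -> s' + t = 1 ->
  s' * pair_value x u + t * pair_value z v
    <= pair_value (s' * x + t * z) (s' * u + t * v).
Proof.
move=> /andP[x0 x1] /andP[z0 z1] /andP[u0 ub] /andP[v0 vb] s0 t0 st.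
have tE : t = 1 - s' by lra.
have -> : s' * pair_value x u + t * pair_value z v =
    (persp F1 (s' * x) (s' * u) + persp F1 (t * z) (t * v)) +
    (persp F2 (s' * (1 - x)) (s' * (b - u)) +
     persp F2 (t * (1 - z)) (t * (b - v))).
  by rewrite !persp_homog /pair_value; ring.
rewrite /pair_value lerD //.
  by apply: persp_superadd => //; rewrite mulr_ge0.
have -> : 1 - (s' * x + t * z) = s' * (1 - x) + t * (1 - z).
  by rewrite tE; ring.
have -> : b - (s' * u + t * v) = s' * (b - u) + t * (b - v).
  by rewrite tE; ring.
by apply: persp_superadd => //; rewrite mulr_ge0 ?subr_ge0.
Qed.

Lemma pair_value_concave a : 0 <= a <= 1 -> concave_on 0 b (pair_value a).
Proof.
move=> a01 x y z x0 xy yz zb.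
have [E|ne] := eqVneq x z.
  have [-> ->] : y = z /\ x = z by lra.
  by rewrite subrr !mul0r addr0.
have pos : 0 < z - x by rewrite subr_gt0 lt_neqAle ne; lra.
have := @pair_value_concave2 a a x z ((z - y) / (z - x)) ((y - x) / (z - x)).
have -> : (z - y) / (z - x) * x + (y - x) / (z - x) * z = y by field; lra.
have -> : (z - y) / (z - x) * a + (y - x) / (z - x) * a = a by field; lra.
move=> H; rewrite [leRHS]mulrC -ler_pdivrMr // mulrDl mulrAC [(y - x) * _ / _]mulrAC.
apply: H => //; try lra; last by field; lra.
  by rewrite divr_ge0 ?subr_ge0 // ltW // -subr_gt0.
by rewrite divr_ge0 ?subr_ge0 // ltW // -subr_gt0.
Qed.

(** On the segment from 0 to b, d^q = d^(q-e) d^e <= b^(q-e) d^e; this lowers the exponent [q] to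
    the common exponent [e]. *)
Let C1 := G * b `^ (q - e).

Let C1_ge0 : 0 <= C1. Proof. by rewrite mulr_ge0 ?powR_ge0. Qed.

Let lower_exponent d : 0 <= d <= b -> G * d `^ q <= C1 * d `^ e.
Proof.
move=> /andP[d0 db]; rewrite /C1 -mulrA ler_wpM2l //.
have qN0 : (q == 0) = false by rewrite gt_eqF // (lt_le_trans e_gt0).
have -> : d `^ q = d `^ (q - e) * d `^ e by rewrite -powRD subrK // qN0.
by rewrite ler_wpM2r ?powR_ge0 // ge0_ler_powR ?nnegrE ?subr_ge0.
Qed.

(** Moving budget to the first loss cannot raise the second term, so the gain is at most that of the
    first perspective at budget 0. *)
Lemma pair_value_left a d : 0 <= a <= 1 -> 0 <= d <= b ->
  pair_value a d - pair_value a 0 <= C1 * d `^ e.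
Proof.
move=> a01 db; apply: le_trans (lower_exponent db).
have := persp_holder G_ge0 q1 F1_holder a01 (d := d).
have : persp F2 (1 - a) (b - d) <= persp F2 (1 - a) (b - 0).
  by apply: persp_mono => //; lra.
rewrite /pair_value; lra.
Qed.

Lemma pair_value_right a d : 0 <= a <= 1 -> 0 <= d <= b ->
  pair_value a (b - d) - pair_value a b <= C1 * d `^ e.
Proof.
move=> a01 db; apply: le_trans (lower_exponent db).
have := @persp_holder _ _ _ _ (1 - a) d G_ge0 q1 F2_holder.
have : persp F1 a (b - d) <= persp F1 a b.
  by apply: persp_mono => //; lra.
rewrite /pair_value subrr subKr; lra.
Qed.

Lemma pair_value_holder a x y : 0 <= a <= 1 -> 0 <= x <= b -> 0 <= y <= b ->
  pair_value a x - pair_value a y <= C1 * `|x - y| `^ e.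
Proof.
move=> a01; apply: concave_holder => //; first exact: pair_value_concave.
  by move=> d; rewrite subr0 add0r; exact: pair_value_left.
by move=> d; rewrite subr0; exact: pair_value_right.
Qed.

(** The exact partial maximum over the budget split, which the inner solver approximates. *)
Definition inner_max (H : R -> R) := forall a, 0 <= a <= 1 ->
  (exists2 be, 0 <= be <= b & pair_value a be = H a) /\
  forall be, 0 <= be <= b -> pair_value a be <= H a.

Lemma inner_max_exists : exists H, inner_max H.
Proof.
have [|bs bsP] := @choice R R (fun a be => 0 <= a <= 1 -> 0 <= be <= b /\
    forall be', 0 <= be' <= b -> pair_value a be' <= pair_value a be).
  move=> a; have [a01|Na01] := boolP (0 <= a <= 1); last by exists 0.
  have [||be beb bemax] := concave_argmax (pair_value_concave a01) C1_ge0 e_gt0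
      _ _ b_ge0.
  - by move=> d; rewrite subr0 add0r; exact: pair_value_left.
  - by move=> d; rewrite subr0; exact: pair_value_right.
  - by exists be => _.
exists (fun a => pair_value a (bs a)) => a /bsP[bsb bsmax].
by split=> //; exists (bs a).
Qed.

Section Outer.
Variable H : R -> R.
Hypothesis HP : inner_max H.

(** Partial maximization preserves joint concavity: the optimal budgets at the two ends are combined
    with the same coefficients as the weights. *)
Lemma inner_max_concave : concave_on 0 1 H.
Proof.
move=> x y z x0 xy yz z1.
have [E|ne] := eqVneq x z.
  have [-> ->] : y = z /\ x = z by lra.
  by rewrite subrr !mul0r addr0.
have pos : 0 < z - x by rewrite subr_gt0 lt_neqAle ne; lra.
have x01 : 0 <= x <= 1 by lra.
have y01 : 0 <= y <= 1 by lra.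
have z01 : 0 <= z <= 1 by lra.
have [[u ub <-] _] := HP x01; have [[v vb <-] _] := HP z01.
have := @pair_value_concave2 x z u v ((z - y) / (z - x)) ((y - x) / (z - x)).
have -> : (z - y) / (z - x) * x + (y - x) / (z - x) * z = y by field; lra.
have c1 : 0 <= (z - y) / (z - x).
  by rewrite divr_ge0 ?subr_ge0 // ltW // -subr_gt0.
have c2 : 0 <= (y - x) / (z - x).
  by rewrite divr_ge0 ?subr_ge0 // ltW // -subr_gt0.
have c12 : (z - y) / (z - x) + (y - x) / (z - x) = 1 by field; lra.
move=> /(_ x01 z01 ub vb c1 c2 c12) le.
rewrite [leRHS]mulrC -ler_pdivrMr // mulrDl mulrAC [(y - x) * _ / _]mulrAC.
apply: le_trans le _; have [_] := HP y01; apply.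
have -> : (y - x) / (z - x) = 1 - (z - y) / (z - x) by lra.
by apply/andP; split; nra.
Qed.

(** Both values at radius 0 are included, so one constant serves at both endpoints. *)
Let C2 := A * (1 + b `^ s) + `|F1 0| + `|F2 0|.

Let C2_ge0 : 0 <= C2.
Proof. by rewrite !addr_ge0 ?mulr_ge0 ?addr_ge0 ?powR_ge0. Qed.

Let inner_max_left d : 0 <= d <= 1 -> H d - H 0 <= C2 * d `^ e.
Proof.
move=> d01; have [[be beb <-] _] := HP d01.
have [|_ /(_ 0)] := HP (a := 0); first by rewrite lexx ler01.
rewrite lexx b_ge0 => /(_ isT) H0.
have : pair_value 0 0 = F2 b by rewrite /pair_value persp0 !subr0 persp1 add0r.
have := pair_value_near_endpoint b_ge0 F1_mono F2_mono F2_concave A_ge0 e_gt0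
  s_ge0 es F1_growth d01 beb.
have : 0 <= `|F1 0| * d `^ e by rewrite mulr_ge0 ?powR_ge0.
rewrite /C2; lra.
Qed.

Let inner_max_right d : 0 <= d <= 1 -> H (1 - d) - H 1 <= C2 * d `^ e.
Proof.
move=> d01; have [|[be beb <-] _] := HP (a := 1 - d); first lra.
have [|_ /(_ b)] := HP (a := 1); first by rewrite lexx ler01.
rewrite lexx b_ge0 => /(_ isT) H1.
have : pair_value 1 b = F1 b by rewrite /pair_value persp1 subrr persp0 addr0.
have bb : 0 <= b - be <= b by lra.
have := pair_value_near_endpoint b_ge0 F2_mono F1_mono F1_concave A_ge0 e_gt0
  s_ge0 es F2_growth d01 bb.
rewrite -{1}(subKr 1 d) pair_value_swap.
have : 0 <= `|F2 0| * d `^ e by rewrite mulr_ge0 ?powR_ge0.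
rewrite /C2; lra.
Qed.

Lemma inner_max_holder x y : 0 <= x <= 1 -> 0 <= y <= 1 ->
  H x - H y <= C2 * `|x - y| `^ e.
Proof.
apply: (concave_holder inner_max_concave) => d; rewrite subr0 ?add0r.
  exact: inner_max_left.
exact: inner_max_right.
Qed.

Lemma inner_max_argmax :
  exists2 xs, 0 <= xs <= 1 & forall x, 0 <= x <= 1 -> H x <= H xs.
Proof.
apply: (concave_argmax inner_max_concave C2_ge0 e_gt0) => // d;
  rewrite subr0 ?add0r.
  exact: inner_max_left.
exact: inner_max_right.
Qed.

End Outer.
End PairValue.

(** * Concave functions on R^m and worst-case values *)

Section ConcaveRowVectors.
Context {R : realType} {m : nat}.
Implicit Types (v w z : 'rV[R]_m).

Lemma convex_functionP (D : set 'rV[R]_m) (f : 'rV[R]_m -> R) :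
  convex_function D f -> forall z w (t : R), D z -> D w -> 0 <= t <= 1 ->
  f (t *: z + (1 - t) *: w) <= t * f z + (1 - t) * f w.
Proof.
move=> fc z w t Dz Dw /andP[t0 t1].
by have := fc (Itv01 t0 t1) z w; apply; rewrite inE.
Qed.

Lemma convex_setP (D : set 'rV[R]_m) : convex_set D ->
  forall z w (t : R), D z -> D w -> 0 <= t <= 1 -> D (t *: z + (1 - t) *: w).
Proof.
move=> Dc z w t Dz Dw /andP[t0 t1].
have := Dc z w (Itv01 t0 t1); rewrite !inE; exact.
Qed.

Lemma coord_le_norm v j : `|v ord0 j| <= `|v|.
Proof.
rewrite [leRHS]/Num.Def.normr /= mx_normrE.
by apply/bigmax_geP; right; exists (ord0, j).
Qed.

Section Concave.
Variable f : 'rV[R]_m -> R.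
Hypothesis f_concave : convex_function setT (fun z => - f z).

Lemma concaveP z w (t : R) : 0 <= t <= 1 ->
  t * f z + (1 - t) * f w <= f (t *: z + (1 - t) *: w).
Proof.
by move=> t01; have := convex_functionP f_concave (z := z) (w := w) I I t01; lra.
Qed.

(** Induction on the number of coordinates allowed to be nonzero. With t the last such coordinate, z
    + v is the midpoint of z + 2 (v - t e) and z + 2 t e, which is why the box is doubled; the
    second point lies on a segment where the minimum over the ends is a lower bound. *)
Lemma concave_bounded_below z (B : R) : 0 < B ->
  exists M, forall v, (forall j, `|v ord0 j| <= B) -> M <= f (z + v).
Proof.
move=> B0.
suff gen k : forall B' : R, 0 < B' -> exists M, forall v,
    (forall j, `|v ord0 j| <= B') ->
    (forall j : 'I_m, (k <= j)%N -> v ord0 j = 0) -> M <= f (z + v).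
  have [M HM] := gen m B B0.
  by exists M => v vB; apply: HM => // j; rewrite leqNgt ltn_ord.
elim: k => [|k IH] {B0}B B0.
  exists (f z) => v _ v0; suff -> : v = 0 by rewrite addr0.
  by apply/rowP => j; rewrite v0 // mxE.
have [M HM] := IH (2 * B) ltac:(by lra).
have [km|mk] := ltnP k m; last first.
  exists M => v vB _; apply: HM => [j|j kj].
    by apply: le_trans (vB j) _; lra.
  by have := ltn_ord j; rewrite ltnNge (leq_trans mk kj).
pose e := delta_mx ord0 (Ordinal km) : 'rV[R]_m.
exists (2^-1 * M + 2^-1 * Num.min (f (z + (2 * B) *: e)) (f (z - (2 * B) *: e))).
move=> v vB v0; set N := Num.min _ _.
pose t := v ord0 (Ordinal km).
have tB := vB (Ordinal km); rewrite -/t ler_norml in tB.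
have h1 : M <= f (z + 2 *: (v - t *: e)).
  apply: HM => [j|j kj].
    rewrite !mxE eqxx /= normrM ger0_norm // ler_pM2l //.
    have [->|jk] := eqVneq j (Ordinal km); first by rewrite mulr1 subrr normr0 ltW.
    by rewrite mulr0 subr0.
  rewrite !mxE eqxx /=.
  have [->|jk] := eqVneq j (Ordinal km); first by rewrite mulr1 subrr mulr0.
  rewrite mulr0 subr0 v0 ?mulr0 // ltn_neqAle kj andbT.
  by apply: contraNneq jk => E; exact/eqP/val_inj.
have h2 : N <= f (z + (2 * t) *: e).
  have l01 : 0 <= (t + B) / (2 * B) <= 1.
    by rewrite divr_ge0 ?ler_pdivrMr; lra.
  have := concaveP (z + (2 * B) *: e) (z - (2 * B) *: e) l01.
  have -> : (t + B) / (2 * B) *: (z + (2 * B) *: e) +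
      (1 - (t + B) / (2 * B)) *: (z - (2 * B) *: e) = z + (2 * t) *: e.
    by apply/rowP => j; rewrite !mxE; field; lra.
  move=> /(le_trans _); apply.
  have n1 : N <= f (z + (2 * B) *: e) by rewrite /N ge_min lexx.
  have n2 : N <= f (z - (2 * B) *: e) by rewrite /N ge_min lexx orbT.
  by nra.
have h01 : 0 <= (2^-1 : R) <= 1 by lra.
have := concaveP (z + 2 *: (v - t *: e)) (z + (2 * t) *: e) h01.
have -> : 2^-1 *: (z + 2 *: (v - t *: e)) + (1 - 2^-1) *: (z + (2 * t) *: e)
    = z + v by apply/rowP => j; rewrite !mxE; field.
by lra.
Qed.

(** Let [M] bound [f] from below on the unit sphere around [z]. For the upper bound [z] lies between
    z + v and the sphere point opposite to [v]; for the lower bound z + v lies between [z] and the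
    sphere point in its own direction. *)
Lemma concave_local_bounds z : exists2 G, 0 <= G &
  (forall v, f (z + v) <= f z + G * `|v|) /\
  (forall v, `|v| <= 1 -> f z - G * `|v| <= f (z + v)).
Proof.
have [M HM] := @concave_bounded_below z 1 ltr01.
have Mz : M <= f z.
  by have := HM 0; rewrite addr0; apply=> j; rewrite mxE normr0.
have sphere v : v != 0 -> M <= f (z + `|v|^-1 *: v).
  move=> v0; apply: HM => j; apply: le_trans (coord_le_norm _ _) _.
  by rewrite normrZ ger0_norm ?invr_ge0 ?normr_ge0 // mulVf ?normr_eq0.
exists (f z - M); first lra.
split=> v; (have [->|v0] := eqVneq v 0; first by rewrite normr0 mulr0 !addr0 ?subr0).
  have s0 : 0 < `|v| by rewrite normr_gt0.
  have := sphere (- v); rewrite oppr_eq0 normrN => /(_ v0).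
  set s := `|v| in s0 *; move=> Mle.
  have l01 : 0 <= (1 + s)^-1 <= 1 by rewrite invr_ge0 invf_le1; lra.
  have := concaveP (z + v) (z + s^-1 *: - v) l01.
  have -> : (1 + s)^-1 *: (z + v) + (1 - (1 + s)^-1) *: (z + s^-1 *: - v) = z.
    by apply/rowP => j; rewrite !mxE; field; lra.
  have -> : 1 - (1 + s)^-1 = s / (1 + s) by field; lra.
  rewrite mulrC mulrAC -mulrDl ler_pdivrMr; last lra.
  by nra.
move=> v1.
have s0 : 0 < `|v| by rewrite normr_gt0.
have := sphere v v0; set s := `|v| in s0 v1 *; move=> Mle.
have l01 : 0 <= s <= 1 by lra.
have := concaveP (z + s^-1 *: v) z l01.
have -> : s *: (z + s^-1 *: v) + (1 - s) *: z = z + v.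
  by apply/rowP => j; rewrite !mxE; field; lra.
by nra.
Qed.

Lemma concave_continuous : continuous f.
Proof.
move=> z; have [G G0 [up lo]] := concave_local_bounds z.
apply/(@cvgrPdist_le _ _ _ (nbhs z) (nbhs_filter z)) => eps eps0; apply/nbhs_ballP.
have G1 : 0 < G + 1 by rewrite ltr_wpDl.
exists (Num.min 1 (eps / (G + 1))); first by rewrite /= lt_min ltr01 divr_gt0.
move=> w; rewrite -ball_normE /= lt_min => /andP[w1 w2].
have {}w1 : `|w - z| <= 1 by rewrite distrC ltW.
have le : G * `|w - z| <= eps.
  move: w2; rewrite distrC ltr_pdivlMr // => /ltW; apply: le_trans.
  by rewrite mulrC ler_wpM2l // lerDl.
have := up (w - z); have := lo _ w1; rewrite [z + (w - z)]addrC subrK => l u.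
rewrite ler_norml; apply/andP; split.
  by rewrite lerBrDl lerBlDr (le_trans u) // lerD2l.
by rewrite lerBlDl -lerBlDr (le_trans _ l) // lerD2l lerN2.
Qed.

End Concave.

Section Norm.
Variable nrm : 'rV[R]_m -> R.
Hypothesis nrmP : is_norm nrm.

(** The double negation is the concavity hypothesis above taken at [- nrm], which is how [nrm] is
    shown to be continuous. *)
Lemma norm_neg_concave : convex_function setT (fun z => - - nrm z).
Proof.
case: nrmP => _ _ nZ nD t z w _ _; rewrite !opprK.
change (nrm (t%:inum *: z + (1 - t%:inum) *: w)
  <= t%:inum * nrm z + (1 - t%:inum) * nrm w).
by apply: le_trans (nD _ _) _; rewrite !nZ !ger0_norm.
Qed.

(** The minimum of [nrm] over the compact unit sphere is attained and positive; its inverse is the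
    constant. *)
Lemma norm_dominates : exists2 K, 0 < K & forall v, `|v| <= K * nrm v.
Proof.
case: (nrmP) => n0 ndef nZ nD.
pose S : set 'rV[R]_m := [set v | `|v| = 1].
have unit v : v != 0 -> S (`|v|^-1 *: v).
  by move=> v0; rewrite /S /= normrZ ger0_norm ?invr_ge0 // mulVf ?normr_eq0.
(* An empty sphere forces every vector to be 0, as in dimension zero. *)
have [Sne|Se] := pselect (S !=set0); last first.
  exists 1 => // v; have [->|v0] := eqVneq v 0; first by rewrite normr0 mul1r.
  by case: Se; exists (`|v|^-1 *: v); exact: unit.
have Sc : compact S.
  apply: bounded_closed_compact.
    exists 1; split; first exact: num_real.
    by move=> y y1 v /= ->; exact: ltW.
  apply: (@closed_comp _ _ (Num.norm : 'rV[R]_m -> R) [set 1]).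
    by move=> v _; exact: norm_continuous.
  exact: closed_eq.
have [|v0 v0S v0min] := @EVT_max_rV R m (fun z => - nrm z) S Sne Sc.
  exact/continuous_subspaceT/concave_continuous/norm_neg_concave.
rewrite inE in v0S.
have c0 : 0 < nrm v0.
  rewrite lt_neqAle n0 andbT eq_sym; apply/eqP => /ndef E.
  by move: v0S; rewrite /S /= E normr0 => /eqP; rewrite eq_sym oner_eq0.
exists (nrm v0)^-1; first by rewrite invr_gt0.
move=> v; have [->|vN0] := eqVneq v 0; first by rewrite normr0 mulr_ge0 // invr_ge0.
have := v0min (`|v|^-1 *: v); rewrite inE => /(_ (unit _ vN0)).
rewrite lerN2 nZ ger0_norm ?invr_ge0 // => le.
rewrite mulrC ler_pdivlMr // mulrC -ler_pdivlMr ?normr_gt0 //.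
by rewrite mulrC.
Qed.

End Norm.
End ConcaveRowVectors.

(** * Worst-case values over transport balls *)

Section WorstCase.
Context {R : realType} {m : nat}.
Variables (Z : set 'rV[R]_m) (c : 'rV[R]_m -> 'rV[R]_m -> R).
Variables (nrm : 'rV[R]_m -> R) (p : R) (zh : 'rV[R]_m).
Hypothesis cP : transport_cost Z c.
Hypothesis Z_closed : closed Z.
Hypothesis Z_convex : convex_set Z.
Hypothesis nrmP : is_norm nrm.
Hypothesis p1 : 1 <= p.
Hypothesis c_norm : forall z zh, Z z -> Z zh -> nrm (z - zh) `^ p <= c z zh.
Hypothesis Zzh : Z zh.

Definition cost_ball (u : R) : set 'rV[R]_m := [set z | Z z /\ c z zh <= u].

Lemma cost_ball_center u : 0 <= u -> cost_ball u zh.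
Proof. by case: cP => _ _ cz _ u0; split=> //; rewrite cz. Qed.

Lemma cost_ball_norm u z : cost_ball u z -> nrm (z - zh) <= u `^ p^-1.
Proof.
move=> [Zz czu]; have p0 : 0 < p by rewrite (lt_le_trans ltr01).
case: nrmP => n0 _ _ _.
have le : nrm (z - zh) `^ p <= u by exact: le_trans (c_norm Zz Zzh) czu.
rewrite -[leLHS]powRr1 // -[X in _ `^ X](divff (lt0r_neq0 p0)) powRrM.
rewrite ge0_ler_powR ?nnegrE ?invr_ge0 ?(ltW p0) ?powR_ge0 //.
by rewrite (le_trans _ le) ?powR_ge0.
Qed.

Lemma cost_ball_closed u : closed (cost_ball u).
Proof.
case: cP => _ lsc _ _ z clz.
(* Membership in [Z] comes first because lower semicontinuity of the cost is relative to the product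
   of [Z] with itself. *)
have Zz : Z z by apply: Z_closed; move: clz; apply: closure_subset => w [].
split=> //; rewrite leNgt; apply/negP => ucz.
have [V nV HV] := lsc (z, zh) u ltac:(by rewrite lte_fin).
have {nV} : within (Z `*` Z) (nbhs (z, zh)) V by rewrite nbhs_subspace_in.
move=> [[V1 V2] [/= nV1 nV2] sub].
have [w [[Zw cw] V1w]] := clz _ nV1.
have /HV : V (w, zh).
  by apply: sub; split=> //=; exact: nbhs_singleton.
by rewrite lte_fin /= ltNge cw.
Qed.

Lemma cost_ball_compact u : compact (cost_ball u).
Proof.
apply: bounded_closed_compact; last exact: cost_ball_closed.
have [K K0 HK] := norm_dominates nrmP.
exists (K * u `^ p^-1 + `|zh|); split; first exact: num_real.
move=> y /ltW yM z zu; apply: le_trans yM.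
rewrite -{1}(subrK zh z); apply: le_trans (ler_normD _ _) _.
rewrite lerD2r; apply: (le_trans (HK _)).
by rewrite ler_pM2l // cost_ball_norm.
Qed.

Variable f : 'rV[R]_m -> R.
Hypothesis f_concave : convex_function setT (fun z => - f z).

Definition worst_case (F : R -> R) := forall u, 0 <= u ->
  (exists2 z, cost_ball u z & f z = F u) /\ forall z, cost_ball u z -> f z <= F u.

Lemma worst_case_exists : exists F, worst_case F.
Proof.
have [|zs zsP] := @choice R 'rV[R]_m (fun u z => 0 <= u -> cost_ball u z /\
    forall w, cost_ball u w -> f w <= f z).
  move=> u; have [u0|u0] := boolP (0 <= u); last by exists 0.
  have [||z zb zmax] := @EVT_max_rV R m f (cost_ball u) _ (@cost_ball_compact u).
  - by exists zh; exact: cost_ball_center.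
  - exact/continuous_subspaceT/concave_continuous.
  exists z => _; rewrite inE in zb; split=> // w wb.
  by apply: zmax; rewrite inE.
exists (f \o zs) => u /zsP[zb zmax]; split=> //.
by exists (zs u).
Qed.

Variable F : R -> R.
Hypothesis FP : worst_case F.

Lemma worst_case_mono (u v : R) : 0 <= u -> u <= v -> F u <= F v.
Proof.
move=> u0 uv; have [[z [Zz zu] <-] _] := FP u0.
have [_] := FP (le_trans u0 uv); apply; split=> //; exact: le_trans uv.
Qed.

(** By convexity of the cost, the combination of the two maximizers fits in the ball of the combined
    radius. *)
Lemma worst_case_concave (u v s t : R) : 0 <= u -> 0 <= v -> 0 <= s -> 0 <= t ->
  s + t = 1 -> s * F u + t * F v <= F (s * u + t * v).
Proof.
move=> u0 v0 s0 t0 st.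
have [[z [Zz zu] <-] _] := FP u0; have [[w [Zw wv] <-] _] := FP v0.
have tE : t = 1 - s by lra.
have s01 : 0 <= s <= 1 by lra.
rewrite tE; apply: (le_trans (concaveP f_concave z w s01)).
have [|_] := FP (u := s * u + (1 - s) * v).
  by rewrite addr_ge0 ?mulr_ge0 //; lra.
apply; split; first exact: convex_setP.
case: cP => _ _ _ /(_ _ Zzh) cc.
apply: (le_trans (convex_functionP cc Zz Zw s01)).
by rewrite lerD // ler_wpM2l //; lra.
Qed.

(** The cost dominates a power of a norm, so the ball of radius zero is reduced to its centre. *)
Lemma worst_case_zero : F 0 = f zh.
Proof.
have [[z [Zz zu] <-] _] := FP (lexx 0).
suff -> : z = zh by [].
have /cost_ball_norm : cost_ball 0 z by [].
have p0 : p != 0 by rewrite gt_eqF // (lt_le_trans ltr01).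
rewrite powR0 ?invr_eq0 // => n0.
case: nrmP => nge ndef _ _; apply/eqP; rewrite -subr_eq0; apply/eqP/ndef.
by apply/eqP; rewrite eq_le n0 nge.
Qed.

(** The upper bound of slope [G] at the centre holds globally, and the ball of radius u has norm
    radius at most u^(1/p). *)
Lemma worst_case_holder : exists2 G, 0 <= G &
  forall u, 0 <= u -> F u - F 0 <= G * u `^ p^-1.
Proof.
have [G G0 [up _]] := concave_local_bounds f_concave zh.
have [K K0 HK] := norm_dominates nrmP.
exists (G * K); first by rewrite mulr_ge0 // ltW.
move=> u u0; have [[z zu <-] _] := FP u0.
rewrite worst_case_zero lerBlDl.
have := up (z - zh); rewrite [zh + _]addrC subrK => /le_trans; apply.
rewrite lerD2l -mulrA ler_wpM2l //.
by apply: (le_trans (HK _)); rewrite ler_pM2l // cost_ball_norm.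
Qed.

Lemma worst_case_growth (r g : R) (z0 : 'rV[R]_m) : p = 1 -> 0 <= r -> 0 < g ->
  (forall z, Z z -> f z <= g * (1 + nrm (z - z0) `^ r)) ->
  exists2 A, 0 <= A & forall u, 0 <= u -> F u <= A * (1 + u `^ r).
Proof.
move=> pE r0 g0 fg.
case: nrmP => n0 _ _ nD.
pose D := nrm (zh - z0).
exists (g * (1 + 2 `^ r * (1 + D `^ r))).
  by rewrite mulr_ge0 ?(ltW g0) ?addr_ge0 ?mulr_ge0 ?addr_ge0 ?powR_ge0.
move=> u u0; have [[z zu <-] _] := FP u0.
apply: (le_trans (fg z (proj1 zu))); rewrite -mulrA ler_pM2l //.
have D0 : 0 <= D by exact: n0.
have zb : nrm (z - z0) <= u + D.
  have -> : z - z0 = (z - zh) + (zh - z0) by rewrite addrA subrK.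
  apply: (le_trans (nD _ _)); rewrite lerD2r.
  by have := cost_ball_norm zu; rewrite pE invr1 powRr1.
(* Replacing u + D by twice the maximum gives a bound on the power of a sum at the price of 2^r. *)
have le1 : nrm (z - z0) `^ r <= 2 `^ r * (u `^ r + D `^ r).
  have m0 : 0 <= Num.max u D by rewrite le_max u0.
  apply: (@le_trans _ _ ((2 * Num.max u D) `^ r)).
    apply: ge0_ler_powR; rewrite ?nnegrE ?mulr_ge0 //.
    apply: (le_trans zb); rewrite mulr_natl mulr2n lerD //.
      by rewrite le_max lexx.
    by rewrite le_max lexx orbT.
  rewrite powRM // ler_wpM2l ?powR_ge0 //.
  by case: (leP u D) => _; rewrite ?lerDl ?lerDr powR_ge0.
have := powR_ge0 2 r; have := powR_ge0 u r; have := powR_ge0 D r.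
move: le1; set X := _ `^ r; set Y := 2 `^ r; set Uu := u `^ r; set Dd := D `^ r.
move=> le1 Dd0 U0 Y0.
have : 0 <= Y * Dd * Uu by rewrite !mulr_ge0.
by nra.
Qed.

End WorstCase.

(** * Analysis of PairEval *)

Section IterationCount.
Context {R : realType}.
Implicit Types B eta : R.
Local Notation phi := (golden R).

Lemma ln_golden_lt0 : ln phi < 0.
Proof. by apply: ln_lt0; have := golden_bounds (R := R); lra. Qed.

(** Solve B phi^n = eta for n and round up. Truncation of a negative solution gives 0, hence the
    condition [eta <= B] for the count. *)
Lemma golden_iterations B eta : 0 < B -> 0 < eta -> exists2 n,
  B * phi ^+ n <= eta &
  eta <= B -> n%:R <= (ln B - ln eta) / - ln phi + 1.
Proof.
move=> B0 eta0; set y := (ln B - ln eta) / - ln phi.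
have phi0 := golden_gt0 (R := R); have k0 := ln_golden_lt0.
exists (Num.trunc y).+1.
  rewrite -ler_ln ?posrE ?mulr_gt0 ?exprn_gt0 // lnM ?posrE ?exprn_gt0 //.
  rewrite lnXn // -mulr_natr.
  have := truncnS_gt y; set n := (_.+1)%:R; rewrite /y ltr_pdivrMr; last lra.
  by nra.
move=> etaB; rewrite -[_.+1]addn1 natrD lerD2r truncn_le /y divr_ge0 //; last lra.
by rewrite subr_ge0 ler_ln.
Qed.

Lemma golden_iterations_log B eta0 : 1 <= B -> 0 < eta0 < 1 ->
  exists2 C, 0 < C & forall eta, 0 < eta <= eta0 -> exists2 n,
    B * phi ^+ n <= eta & n.+1%:R <= C * ln eta^-1.
Proof.
move=> B1 /andP[eta00 eta01]; have k0 := ln_golden_lt0.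
have l00 : 0 < - ln eta0 by rewrite oppr_gt0 ln_lt0 // eta00.
have lB : 0 <= ln B by exact: ln_ge0.
(* [D] collects the additive constants; since [eta <= eta0 < 1], they are at most a multiple of ln
   (1/eta). *)
set D := 2 + ln B / - ln phi.
have D0 : 0 < D by rewrite ltr_pwDl // divr_ge0 //; lra.
exists (D / - ln eta0 + (- ln phi)^-1).
  by rewrite addr_gt0 ?divr_gt0 ?invr_gt0 //; lra.
move=> eta /andP[eta_gt0 etale].
have [|n small] := @golden_iterations B eta _ eta_gt0; first by lra.
have etaB : eta <= B by lra.
move=> /(_ etaB) nle; exists n => //.
rewrite lnV ?posrE //.
have le0 : - ln eta0 <= - ln eta by rewrite lerN2 ler_ln ?posrE.
have : D <= D / - ln eta0 * - ln eta.
  by rewrite mulrAC ler_pdivlMr // ler_pM2l.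
rewrite -natr1 mulrDl => h.
have : (ln B - ln eta) / - ln phi = ln B / - ln phi + (- ln phi)^-1 * - ln eta.
  by field; lra.
by rewrite /D in h *; lra.
Qed.

End IterationCount.

Section PerspectiveWorstCase.
Context {R : realType} {m : nat}.
Variables (Z : set 'rV[R]_m) (c : 'rV[R]_m -> 'rV[R]_m -> R) (zh : 'rV[R]_m).
Variables (f : 'rV[R]_m -> R) (F : R -> R).
Hypothesis Zzh : Z zh.
Hypothesis FP : worst_case Z c zh f F.

Lemma persp_attained (a be : R) : 0 <= a -> 0 <= be -> exists v,
  [/\ Z (zh + v), a * c (zh + v) zh <= be & a * f (zh + v) = persp F a be].
Proof.
move=> a0 be0; have [->|aN0] := eqVneq a 0.
  by exists 0; rewrite addr0 persp0 !mul0r.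
have ap : 0 < a by rewrite lt_neqAle eq_sym aN0.
have [|[z [Zz zu] fz] _] := FP (u := be / a); first by rewrite divr_ge0.
exists (z - zh); rewrite [zh + _]addrC subrK; split=> //.
  by rewrite mulrC -ler_pdivlMr.
by rewrite fz.
Qed.

Lemma persp_upper (a be : R) v : 0 <= a -> 0 <= be -> Z (zh + v) ->
  a * c (zh + v) zh <= be -> a * f (zh + v) <= persp F a be.
Proof.
move=> a0 be0 Zv cv; have [->|aN0] := eqVneq a 0.
  by rewrite persp0 mul0r.
have ap : 0 < a by rewrite lt_neqAle eq_sym aN0.
have [|_ Fu] := FP (u := be / a); first by rewrite divr_ge0.
rewrite /persp ler_pM2l //; apply: Fu; split=> //.
by rewrite ler_pdivlMr // mulrC.
Qed.

End PerspectiveWorstCase.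

(** * Feasibility, error and running time of the nested search *)

Section PairEvalAnalysis.
Context {R : realType} {m K : nat}.
Variables (Z : set 'rV[R]_m) (c : 'rV[R]_m -> 'rV[R]_m -> R) (zh : 'rV[R]_m).
Variables (f : 'I_K -> 'rV[R]_m -> R) (k1 k2 : 'I_K) (b : R).
Variables (F1 F2 H : R -> R) (C1 C2 e : R).
Hypothesis Zzh : Z zh.
Hypothesis b_ge0 : 0 <= b.
Hypothesis F1P : worst_case Z c zh (f k1) F1.
Hypothesis F2P : worst_case Z c zh (f k2) F2.
Hypothesis HP : inner_max F1 F2 b H.

Lemma pair_values_maximum (xs : R) : 0 <= xs <= 1 ->
  (forall x, 0 <= x <= 1 -> H x <= H xs) ->
  is_maximum (pair_values Z c (f k1) (f k2) zh b) (H xs).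
Proof.
move=> xs01 xsmax; split.
  have [[be beb <-] _] := HP xs01.
  have [|| v1 [Zv1 cv1 fv1]] := persp_attained Zzh F1P (a := xs) (be := be).
  - lra.
  - lra.
  have [|| v2 [Zv2 cv2 fv2]] :=
    persp_attained Zzh F2P (a := 1 - xs) (be := b - be).
  - lra.
  - lra.
  exists (PairPoint xs (1 - xs) be (b - be) v1 v2).
    by split=> //; [split; lra|lra|lra].
  by rewrite /pair_objective /= fv1 fv2.
move=> _ [[a1 a2 b1 b2 v1 v2] [[a10 a20 b10 b20] [Zv1 Zv2] [cv1 cv2] a12 b12] <-].
rewrite /pair_objective /=.
have u1 := persp_upper F1P a10 b10 Zv1 cv1.
have u2 := persp_upper F2P a20 b20 Zv2 cv2.
have a01 : 0 <= a1 <= 1 by lra.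
apply: le_trans (xsmax _ a01); have [_ Hmax] := HP a01.
apply: le_trans (Hmax b1 _); last lra.
have E1 : 1 - a1 = a2 by lra.
have E2 : b - b1 = b2 by lra.
by rewrite /pair_value E1 E2 lerD.
Qed.

Variables (O : oracle R m K) (eps eta : R).
Hypothesis OP : oracle_assumption Z c f O.
Hypothesis eps_gt0 : 0 < eps.
Hypothesis eta_gt0 : 0 < eta.

Let inner_eval_det a x ev ev' t t' : inner_eval O eps zh k1 k2 b a x ev t ->
  inner_eval O eps zh k1 k2 b a x ev' t' -> ev = ev'.
Proof.
rewrite /inner_eval; case: (wco _ _ _ _ _) => L1 v1.
by case: (wco _ _ _ _ _) => L2 v2 [-> _] [-> _].
Qed.

Lemma oracle_value k F u : worst_case Z c zh (f k) F -> 0 <= u ->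
  F u - eps <= (wco O k eps zh u).1 <= F u.
Proof.
move=> FP u0; have := OP k Zzh u0 eps_gt0.
case: (wco O k eps zh u) => L v [[Zv cv] LE Lmax _] /=.
have [[z [Zz cz] <-] Fmax] := FP _ u0.
have := Lmax (z - zh); rewrite [zh + (z - zh)]addrC subrK => /(_ Zz cz) ->.
by rewrite LE Fmax.
Qed.

(** The weights sum to 1, so the two oracle errors average to at most [eps]; oracle points are
    feasible, so the noise is one-sided. *)
Lemma inner_eval_spec a be ev t : 0 < a < 1 -> 0 <= be <= b ->
  inner_eval O eps zh k1 k2 b a be ev t ->
  [/\ pair_value F1 F2 b a be - eps <= ev.1 <= pair_value F1 F2 b a be,
      pair_feasible Z c zh b ev.2 &
      (t <= wco_cost O k1 eps + wco_cost O k2 eps + 1)%N].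
Proof.
move=> a01 beb; rewrite /inner_eval.
have u1 : 0 <= be / a by rewrite divr_ge0; lra.
have u2 : 0 <= (b - be) / (1 - a) by rewrite divr_ge0; lra.
have := oracle_value F1P u1; have := oracle_value F2P u2.
have := OP k1 Zzh u1 eps_gt0; have := OP k2 Zzh u2 eps_gt0.
case: (wco _ _ _ _ (_ / a)) => L1 v1; case: (wco _ _ _ _ _) => L2 v2 /=.
move=> [[Zv2 cv2] _ _ t2] [[Zv1 cv1] _ _ t1] l2 l1 [-> ->].
have a0 : 0 < a by lra.
have a1 : 0 < 1 - a by lra.
split.
- case/andP: l1 l2 => lo1 up1 /andP[lo2 up2].
  have := ler_wpM2l (ltW a0) lo1; have := ler_wpM2l (ltW a0) up1.
  have := ler_wpM2l (ltW a1) lo2; have := ler_wpM2l (ltW a1) up2.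
  by rewrite /pair_value /persp /=; lra.
- split=> //=; [split; lra| |lra|lra].
  by rewrite ![_ * c _ _]mulrC -!ler_pdivlMr.
- by case/andP: t1 t2 => _ t1 /andP[_ t2]; rewrite leq_add2r leq_add.
Qed.

Hypothesis e_gt0 : 0 < e.
Hypothesis e_le1 : e <= 1.
Hypothesis C1_ge0 : 0 <= C1.
Hypothesis C2_ge0 : 0 <= C2.
Hypothesis pair_concave :
  forall a, 0 <= a <= 1 -> concave_on 0 b (pair_value F1 F2 b a).
Hypothesis pair_holder : forall a x y, 0 <= a <= 1 ->
  0 <= x <= b -> 0 <= y <= b ->
  pair_value F1 F2 b a x - pair_value F1 F2 b a y <= C1 * `|x - y| `^ e.
Hypothesis H_concave : concave_on 0 1 H.
Hypothesis H_holder : forall x y, 0 <= x <= 1 -> 0 <= y <= 1 ->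
  H x - H y <= C2 * `|x - y| `^ e.

(** Since phi > 1/2, d <= 2 eta, and 2^e <= 2 because e <= 1. *)
Let tolerance_modulus (C d : R) : 0 <= C -> 0 <= d -> golden R * d <= eta ->
  C * d `^ e <= 2 * C * eta `^ e.
Proof.
move=> C0 d0 small; rewrite -mulrA mulrCA ler_wpM2l //.
have d2 : d <= 2 * eta by have := golden_bounds (R := R); nra.
apply: (@le_trans _ _ ((2 * eta) `^ e)).
  by rewrite ge0_ler_powR ?nnegrE ?mulr_ge0 // ltW.
rewrite powRM ?(ltW eta_gt0) // ler_wpM2r ?powR_ge0 // ler1_powR //.
by rewrite ler1n.
Qed.

Let interior_open (a : R) : interior_pt 0 1 a -> 0 < a < 1.
Proof. by case=> _; apply; exact: ltr01. Qed.

(** To the outer search, the inner solver is an evaluation of [H] with one-sided noise: three times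
    the oracle error plus the modulus of the budget split. *)
Lemma InnerSolver_spec a ev t : 0 < a < 1 ->
  InnerSolver O eps eta zh k1 k2 b a ev t ->
  [/\ H a - (3 * eps + 2 * C1 * eta `^ e) <= ev.1 <= H a,
      pair_feasible Z c zh b ev.2 &
      forall n, b * golden R ^+ n <= eta ->
        (t <= (2 * (wco_cost O k1 eps + wco_cost O k2 eps + 1) + 1) * n.+1)%N].
Proof.
move=> a01 run.
have a01' : 0 <= a <= 1 by lra.
have [[be beb beE] Hmax] := HP a01'.
have spec x e' t' : interior_pt 0 b x ->
    inner_eval O eps zh k1 k2 b a x e' t' -> _ :=
  fun xi => @inner_eval_spec a x e' t' a01 (proj1 xi).
split.
- apply/andP; split; last first.
    apply: (golden_search_inv (Q := fun ev => ev.1 <= H a) b_ge0 _ run).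
    move=> x e' t' xi /(spec _ _ _ xi)[+ _ _].
    by have := Hmax x (proj1 xi); lra.
  have := golden_search_error (h := pair_value F1 F2 b a) (xs := be)
    (delta := eps) (omega := 2 * C1 * eta `^ e) b_ge0 (pair_concave a01') beb
    _ (ltW eps_gt0) _ _ _ (ltW eta_gt0) run.
  rewrite beE opprD addrA; apply.
  + by move=> x /Hmax.
  + by move=> x e' t' xi /(spec _ _ _ xi)[].
  + by move=> x e1 e2 t1 t2 _ ev1 /(inner_eval_det ev1) ->.
  + move=> x xb small; rewrite -beE; apply: (le_trans (pair_holder a01' beb xb)).
    by rewrite distrC; exact: tolerance_modulus.
- apply: (golden_search_inv (Q := fun ev => pair_feasible Z c zh b ev.2)
    b_ge0 _ run).
  by move=> x e' t' xi /(spec _ _ _ xi)[].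
- move=> n small; rewrite -[b]subr0 in small.
  apply: (golden_search_time b_ge0 _ small run).
  by move=> x e' t' xi /(spec _ _ _ xi)[].
Qed.

Lemma InnerSolver_total a : exists ev t, InnerSolver O eps eta zh k1 k2 b a ev t.
Proof.
have [|n small _] := @golden_iterations R (b + 1) eta _ eta_gt0.
  by move: b_ge0; lra.
apply: (@golden_search_total _ _ _ _ n); last first.
  apply: le_trans small; rewrite subr0 ler_wpM2r ?lerDl //.
  by rewrite exprn_ge0 // ltW // golden_gt0.
move=> x; rewrite /inner_eval.
case: (wco _ _ _ _ _) => L1 v1; case: (wco _ _ _ _ _) => L2 v2.
by eexists; eexists; split; reflexivity.
Qed.

Lemma PairEval_total : exists ev t, PairEval O eps eta zh k1 k2 b ev t.
Proof.
have [|n small _] := @golden_iterations R 1 eta _ eta_gt0; first exact: ltr01.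
apply: (@golden_search_total _ _ _ _ n); last by rewrite subr0.
exact: InnerSolver_total.
Qed.

Lemma PairEval_feasible ev t : PairEval O eps eta zh k1 k2 b ev t ->
  pair_feasible Z c zh b ev.2.
Proof.
apply: (golden_search_inv (Q := fun ev => pair_feasible Z c zh b ev.2)).
  exact: ler01.
by move=> x e' t' /interior_open x01 /(InnerSolver_spec x01)[].
Qed.

(** The outer search triples the inner error, giving 9 eps and 6 C1 eta^e, and adds its own modulus
    2 C2 eta^e. *)
Lemma PairEval_error xs ev t : 0 <= xs <= 1 ->
  (forall x, 0 <= x <= 1 -> H x <= H xs) ->
  PairEval O eps eta zh k1 k2 b ev t ->
  `|H xs - ev.1| <= (9 + 6 * C1 + 2 * C2) * (eps + eta `^ e).
Proof.
move=> xs01 xsmax run.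
have up : ev.1 <= H xs.
  apply: (golden_search_inv (Q := fun ev => ev.1 <= H xs) ler01 _ run).
  move=> x e' t' xi /(InnerSolver_spec (interior_open xi))[/andP[_ le] _ _].
  exact: le_trans le (xsmax _ (proj1 xi)).
have eta_e : 0 <= eta `^ e by exact: powR_ge0.
have := golden_search_error (h := H) (xs := xs)
  (delta := 3 * eps + 2 * C1 * eta `^ e)
  (omega := 2 * C2 * eta `^ e) ler01 H_concave xs01 xsmax
  _ _ _ _ (ltW eta_gt0) run.
have d0 : 0 <= 3 * eps + 2 * C1 * eta `^ e.
  by rewrite addr_ge0 ?mulr_ge0 // ltW.
move=> /(_ d0) lo; rewrite ger0_norm ?subr_ge0 //.
have : H xs - 3 * (3 * eps + 2 * C1 * eta `^ e) - 2 * C2 * eta `^ e <= ev.1.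
  apply: lo.
  - by move=> x e' t' /interior_open x01 /(InnerSolver_spec x01)[].
  - move=> x e1 e2 t1 t2 _; apply: golden_search_det => y.
    exact: inner_eval_det.
  - move=> x xb small; apply: (le_trans (H_holder xs01 xb)).
    by rewrite distrC; exact: tolerance_modulus.
have h1 : 0 <= C1 * eps by rewrite mulr_ge0 // ltW.
have h2 : 0 <= C2 * eps by rewrite mulr_ge0 // ltW.
by nra.
Qed.

Lemma PairEval_time n ev t : b * golden R ^+ n <= eta -> golden R ^+ n <= eta ->
  PairEval O eps eta zh k1 k2 b ev t ->
  (t <= 15 * (wco_cost O k1 eps + wco_cost O k2 eps) * n.+1 ^ 2)%N.
Proof.
move=> small1 small2 run.
have cost k : (0 < wco_cost O k eps)%N.
  have := OP k Zzh (lexx 0) eps_gt0; case: (wco _ _ _ _ _) => L v [_ _ _] /andP[].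
  exact: leq_trans.
have := cost k1; have := cost k2; set S := (_ + _)%N => c1 c2.
have small : (1 - 0) * golden R ^+ n <= eta by rewrite subr0 mul1r.
have inner x e' t' : interior_pt 0 1 x ->
    InnerSolver O eps eta zh k1 k2 b x e' t' ->
    (t' <= (2 * (S + 1) + 1) * n.+1)%N.
  by move=> /interior_open x01 /(InnerSolver_spec x01)[_ _]; exact.
apply: leq_trans (golden_search_time ler01 inner small run) _.
(* Every oracle call takes at least one step, so the additive overhead of both loops is absorbed
   into the multiple 15 of [S]. *)
have S2 : (2 <= S)%N by rewrite (leq_add c2 c1).
by clear -S2; move: n.+1 (ltn0Sn n) => n' n'0; nia.
Qed.

End PairEvalAnalysis.

Section Exponents.
Context {R : realType}.
Implicit Types p r : R.

(** Growth exponent of the worst-case values at infinity: the order of the norm radius when p > 1,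
    the exponent of the growth condition when p = 1. *)
Definition growth_order p r : R := if p == 1 then r else p^-1.

(** The bound by 1/p serves the budget search, and the bound by one minus the growth order serves
    the weight search. *)
Lemma error_rate_bounds p r : 1 <= p -> (p = 1 -> 0 <= r < 1) ->
  [/\ 0 < error_rate p r, error_rate p r <= p^-1, p^-1 <= 1,
      0 <= growth_order p r & error_rate p r <= 1 - growth_order p r].
Proof.
move=> p1 rP; rewrite /error_rate /growth_order.
have [pE|pN1] := eqVneq p 1.
  by have := rP pE; rewrite pE invr1 => r01; split; lra.
have p_gt1 : 1 < p by rewrite lt_neqAle eq_sym pN1.
have p0 : 0 < p by lra.
have ip : 0 < p^-1 by rewrite invr_gt0.
have ip1 : p^-1 < 1 by rewrite invf_lt1.
by rewrite lt_min !ge_min !lexx orbT; split=> //; lra.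
Qed.

End Exponents.

Lemma le_loss (R : realType) (n m K : nat)
    (ell : 'I_K -> 'rV[R]_n -> 'rV[R]_m -> R) k x z :
  ((ell k x z)%:E <= loss ell x z)%E.
Proof. exact: le_bigmax. Qed.

Lemma worst_case_sublinear (R : realType) (n m K : nat)
    (Z : set 'rV[R]_m) (c : 'rV[R]_m -> 'rV[R]_m -> R) (zh : 'rV[R]_m)
    (ell : 'I_K -> 'rV[R]_n -> 'rV[R]_m -> R) (nrm : 'rV[R]_m -> R)
    (p r : R) x k F :
  is_norm nrm -> 1 <= p ->
  (forall z zh, Z z -> Z zh -> nrm (z - zh) `^ p <= c z zh) -> Z zh ->
  convex_function setT (fun z => - ell k x z) ->
  (p = 1 -> growth_exponent Z ell nrm x r) ->
  worst_case Z c zh (ell k x) F ->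
  exists2 A, 0 <= A &
    forall u, 0 <= u -> F u <= A * (1 + u `^ growth_order p r).
Proof.
move=> nrmP p1 c_norm Zzh fc growth FP; rewrite /growth_order.
have [pE|pN1] := eqVneq p 1.
  have [/andP[r0 _] [g [z0 [g0 _ gP]]]] := growth pE.
  apply: (worst_case_growth nrmP p1 c_norm Zzh FP pE r0 g0 (z0 := z0)) => z Zz.
  by rewrite -lee_fin; exact: le_trans (le_loss _ _ _ _) (gP _ Zz).
have [G G0 FG] := worst_case_holder nrmP p1 c_norm Zzh fc FP.
exists (`|F 0| + G); first by rewrite addr_ge0.
move=> u u0; have := FG _ u0; have := ler_norm (F 0).
have : 0 <= `|F 0| * u `^ p^-1 by rewrite mulr_ge0 ?powR_ge0.
by lra.
Qed.

Theorem lemma2 (R : realType) (n m N K : nat)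
  (X : set 'rV[R]_n) (Z : set 'rV[R]_m)
  (c : 'rV[R]_m -> 'rV[R]_m -> R)
  (zhat : 'I_N -> 'rV[R]_m) (rho : R)
  (ell : 'I_K -> 'rV[R]_n -> 'rV[R]_m -> R)
  (nrm : 'rV[R]_m -> R) (p r : R)
  (x : 'rV[R]_n) (i : 'I_N) (b : R) (k1 k2 : 'I_K) :
  transport_cost Z c ->
  (forall j, Z (zhat j)) ->
  0 < rho ->
  regularity X Z c zhat rho ell nrm p ->
  X x ->
  (p = 1 -> growth_exponent Z ell nrm x r) ->
  0 <= b ->
  (k1 < k2)%N ->
  exists V : R,
    [/\ is_maximum (pair_values Z c (ell k1 x) (ell k2 x) (zhat i) b) V,
        exists C : R,
          forall (O : oracle R m K) (eps eta : R),
            oracle_assumption Z c (fun k => ell k x) O ->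
            0 < eps -> 0 < eta ->
            (exists out t, PairEval O eps eta (zhat i) k1 k2 b out t) /\
            forall (Vhat : R) (shat : pair_point R m) (t : nat),
              PairEval O eps eta (zhat i) k1 k2 b (Vhat, shat) t ->
              pair_feasible Z c (zhat i) b shat /\
              `|V - Vhat| <= C * (eps + eta `^ error_rate p r)
      & forall eta0 : R, 0 < eta0 < 1 ->
        exists (C : R) (q : nat),
          forall (O : oracle R m K) (eps eta : R),
            oracle_assumption Z c (fun k => ell k x) O ->
            0 < eps -> 0 < eta <= eta0 ->
            forall (Vhat : R) (shat : pair_point R m) (t : nat),
              PairEval O eps eta (zhat i) k1 k2 b (Vhat, shat) t ->
              t%:R <= softO_bound C q
                ((wco_cost O k1 eps + wco_cost O k2 eps)%N%:R * ln (eta^-1) ^+ 2)].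
Proof.
move=> cP zhatZ _ reg Xx growth b_ge0 _.
have fc k := reg_ell_concave reg k x.
case: reg => _ _ _ _ Zcl Zcv _ _ _ nrmP p1 c_norm _.
have Zzh := zhatZ i; set zh := zhat i in Zzh *.
have [F1 F1P] := worst_case_exists cP Zcl nrmP p1 c_norm Zzh (fc k1).
have [F2 F2P] := worst_case_exists cP Zcl nrmP p1 c_norm Zzh (fc k2).
have F1m := worst_case_mono F1P; have F2m := worst_case_mono F2P.
have F1c := worst_case_concave cP Zcv Zzh (fc k1) F1P.
have F2c := worst_case_concave cP Zcv Zzh (fc k2) F2P.
have [G1 G1_ge0 F1h] := worst_case_holder nrmP p1 c_norm Zzh (fc k1) F1P.
have [G2 G2_ge0 F2h] := worst_case_holder nrmP p1 c_norm Zzh (fc k2) F2P.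
have [A1 A1_ge0 F1g] :=
  worst_case_sublinear nrmP p1 c_norm Zzh (fc k1) growth F1P.
have [A2 A2_ge0 F2g] :=
  worst_case_sublinear nrmP p1 c_norm Zzh (fc k2) growth F2P.
have [e_gt0 e_le_q q1 s_ge0 es] :=
  error_rate_bounds p1 (fun pE => proj1 (growth pE)).
set e := error_rate p r in e_gt0 e_le_q es *.
set s := growth_order p r in s_ge0 es F1g F2g.
have e_le1 : e <= 1 by lra.
(* Summing the constants gives bounds common to both losses. *)
have G_ge0 : 0 <= G1 + G2 by lra.
have A_ge0 : 0 <= A1 + A2 by lra.
have {}F1h u : 0 <= u -> F1 u - F1 0 <= (G1 + G2) * u `^ p^-1.
  move=> /F1h; have : 0 <= G2 * u `^ p^-1 by rewrite mulr_ge0 ?powR_ge0.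
  by lra.
have {}F2h u : 0 <= u -> F2 u - F2 0 <= (G1 + G2) * u `^ p^-1.
  move=> /F2h; have : 0 <= G1 * u `^ p^-1 by rewrite mulr_ge0 ?powR_ge0.
  by lra.
have {}F1g u : 0 <= u -> F1 u <= (A1 + A2) * (1 + u `^ s).
  move=> /F1g; have : 0 <= A2 * (1 + u `^ s).
    by rewrite mulr_ge0 ?addr_ge0 ?powR_ge0.
  by lra.
have {}F2g u : 0 <= u -> F2 u <= (A1 + A2) * (1 + u `^ s).
  move=> /F2g; have : 0 <= A1 * (1 + u `^ s).
    by rewrite mulr_ge0 ?addr_ge0 ?powR_ge0.
  by lra.
have pconc a : 0 <= a <= 1 -> concave_on 0 b (pair_value F1 F2 b a).
  exact: pair_value_concave.
have phold := pair_value_holder b_ge0 F1m F2m F1c F2c G_ge0 e_gt0 e_le_q q1 F1h F2h.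
have [H HP] := inner_max_exists b_ge0 F1m F2m F1c F2c G_ge0 e_gt0 e_le_q q1 F1h F2h.
have Hconc := inner_max_concave F1m F2m F1c F2c HP.
have Hhold := inner_max_holder b_ge0 F1m F2m F1c F2c A_ge0 e_gt0 s_ge0 es
  F1g F2g HP.
have [xs xs01 xsmax] := inner_max_argmax b_ge0 F1m F2m F1c F2c A_ge0 e_gt0
  s_ge0 es F1g F2g HP.
set C1 := (G1 + G2) * _ in phold; set C2 := _ + _ in Hhold.
have C1_ge0 : 0 <= C1 by rewrite mulr_ge0 ?powR_ge0.
have C2_ge0 : 0 <= C2.
  by rewrite !addr_ge0 ?mulr_ge0 ?addr_ge0 ?powR_ge0.
exists (H xs); split.
- exact: (pair_values_maximum (f := fun k => ell k x) Zzh F1P F2P HP xs01 xsmax).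
- exists (9 + 6 * C1 + 2 * C2) => O eps eta OP eps_gt0 eta_gt0; split.
    exact: PairEval_total.
  move=> Vhat shat t run; split.
    exact: (PairEval_feasible Zzh b_ge0 F1P F2P HP OP eps_gt0 eta_gt0 e_gt0
      e_le1 C1_ge0 pconc phold run).
  exact: (PairEval_error Zzh b_ge0 F1P F2P HP OP eps_gt0 eta_gt0 e_gt0
      e_le1 C1_ge0 C2_ge0 pconc phold Hconc Hhold xs01 xsmax run).
- move=> eta0 eta001.
  (* The length max(1, b) lets a single iteration count serve both the weight search and the budget
     search. *)
  have [|C0 C0_gt0 iter] := @golden_iterations_log R (Num.max 1 b) eta0 _ eta001.
    by rewrite le_max lexx.
  (* The square comes from the nested loops; no logarithmic factor beyond ln (1/eta)^2 arises, so
     the power [q] is 0. *)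
  exists (15 * C0 ^+ 2), 0%N => O eps eta OP eps_gt0 eta_bd Vhat shat t run.
  have [n' small nle] := iter _ eta_bd.
  have eta_gt0 : 0 < eta by lra.
  have phin : 0 <= golden R ^+ n' by rewrite exprn_ge0 // ltW // golden_gt0.
  have small1 : b * golden R ^+ n' <= eta.
    by apply: le_trans small; rewrite ler_wpM2r // le_max lexx orbT.
  have small2 : golden R ^+ n' <= eta.
    by apply: le_trans small; rewrite ler_peMl // le_max lexx.
  have := PairEval_time Zzh b_ge0 F1P F2P HP OP eps_gt0 eta_gt0 e_gt0
    e_le1 C1_ge0 pconc phold small1 small2 run.
  set S := (_ + _)%N => tle.
  rewrite /softO_bound expr0 mulr1.
  apply: (@le_trans _ _ ((15 * S * n'.+1 ^ 2)%N%:R)); first by rewrite ler_nat.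
  rewrite 2!natrM natrX.
  have -> : 15 * C0 ^+ 2 * (S%:R * ln eta^-1 ^+ 2)
      = 15%:R * S%:R * (C0 * ln eta^-1) ^+ 2 by ring.
  by rewrite ler_wpM2l ?mulr_ge0 // lerXn2r ?nnegrE // (le_trans _ nle).
Qed.
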